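(* Let $X\subset\mathbb{R}^2$ be a closed definable curve such that $0\in X$ and the germ $(X\setminus\{0\},0)$ is connected. Then $0\in\overline{M_X}$ if and only if $X$ is superquadratic at zero.
   Context: ''Definable'' means definable in a fixed o-minimal structure over the field of real numbers that is, in addition, polynomially bounded. Let $d(x,X)$ denote the Euclidean distance from $x\in\mathbb{R}^n$ to $X\subset\mathbb{R}^n$. For a closed, nonempty, proper subset $X\subset\mathbb{R}^n$ put $m(x)=\{y\in X : d(x,X)=\|x-y\|\}$ (the set of closest points to $x$ in $X$). The medial axis of $X$ is $M_X=\{x\in\mathbb{R}^n\setminus X : \# m(x)>1\}$. If $X\subset\mathbb{R}^2$ is a definable curve with $0\in X$ and the germ $(X\setminus\{0\},0)$ connected, this means that $X$ has a single branch ending at the origin. Then the tangent cone of $X$ at $0$ is a half-line, which in suitably chosen (rotated/reflected) orthonormal coordinates is $[0,+\infty)\times\{0\}$, and in these coordinates $X$ is, near zero, the graph of a definable $\mathcal{C}^1$ function $f\colon[0,\varepsilon)\to\mathbb{R}$ with $f(0)=0$ and $f'(0)=0$. If $f\not\equiv 0$ (near $0$), then for $0<t\ll 1$ one can write $f(t)=at^{\alpha}+o(t^{\alpha})$ with $a\neq 0$, $\alpha\geq 1$. $X$ is called superquadratic at zero if and only if $f\not\equiv 0$ near $0$ and $\alpha<2$. *)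

(* Defs.v *)
From HB Require Import structures.
From mathcomp Require Import all_boot all_order all_algebra.
From mathcomp Require Import all_classical all_reals all_analysis.

Set Implicit Arguments.
Unset Strict Implicit.
Unset Printing Implicit Defensive.

Import Order.TTheory GRing.Theory Num.Theory.
Import numFieldNormedType.Exports.

Local Open Scope classical_set_scope.
Local Open Scope ring_scope.

(* O-minimal structure on the real field, in the sense of van den Dries and
   Miller. The last axiom makes every real singleton definable, so
   definability is with real parameters. *)
Record ominimal_structure (R : realType) := OMinimalStructure {
  definable : forall n : nat, set (set 'rV[R]_n);
  definable_set0 : forall n, definable (set0 : set 'rV[R]_n);
  definable_setU : forall n (A B : set 'rV[R]_n),
    definable A -> definable B -> definable (A `|` B);
  definable_setC : forall n (A : set 'rV[R]_n),
    definable A -> definable (~` A);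
  definable_prodr : forall n (A : set 'rV[R]_n),
    definable A -> definable [set x : 'rV[R]_(n + 1) | A (lsubmx x)];
  definable_prodl : forall n (A : set 'rV[R]_n),
    definable A -> definable [set x : 'rV[R]_(1 + n) | A (rsubmx x)];
  definable_diag : forall n (i j : 'I_n),
    definable [set x : 'rV[R]_n | x 0 i = x 0 j];
  definable_proj : forall n (A : set 'rV[R]_(n + 1)),
    definable A -> definable (lsubmx @` A : set 'rV[R]_n);
  definable_add :
    definable [set x : 'rV[R]_3 | x 0 0 + x 0 1 = x 0 ord_max];
  definable_mul :
    definable [set x : 'rV[R]_3 | x 0 0 * x 0 1 = x 0 ord_max];
  definable_line : forall A : set 'rV[R]_1,
    definable A <->
    exists s : seq (interval R),
      A = [set x | exists2 i, i \in s & x 0 0 \in i] }.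

Arguments definable {R} S [n] A : rename.

Definition graph_on (R : realType) (D : set R) (f : R -> R) : set 'rV[R]_2 :=
  [set z | D (z 0 0) /\ z 0 1 = f (z 0 0)].

Definition polynomially_bounded (R : realType) (S : ominimal_structure R) :=
  forall f : R -> R, definable S (graph_on setT f) ->
  exists N : nat, \forall t \near +oo, `|f t| <= t ^+ N.

(* Dimension of a definable set: the largest d such that some projection
   onto d of the coordinates has nonempty interior. *)
Definition fat_projection (R : realType) n (A : set 'rV[R]_n) (d : nat) :=
  exists s : 'I_d -> 'I_n,
    injective s /\ interior ((colsub s : 'rV[R]_n -> 'rV[R]_d) @` A) !=set0.

Definition has_dimension (R : realType) n (A : set 'rV[R]_n) (d : nat) :=
  fat_projection A d /\ forall k, fat_projection A k -> (k <= d)%N.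

Definition definable_curve (R : realType) (S : ominimal_structure R) n
    (X : set 'rV[R]_n) :=
  definable S X /\ has_dimension X 1.

(* The norm of the library on 'rV[R]_n is the sup norm. *)
Definition euclidean_norm (R : realType) n (x : 'rV[R]_n) : R :=
  Num.sqrt (\sum_i (x 0 i) ^+ 2).

Definition distance_to (R : realType) n (x : 'rV[R]_n) (X : set 'rV[R]_n) : R :=
  inf [set euclidean_norm (x - y) | y in X].

Definition closest_points (R : realType) n (X : set 'rV[R]_n) (x : 'rV[R]_n) :
    set 'rV[R]_n :=
  [set y | X y /\ distance_to x X = euclidean_norm (x - y)].

Definition medial_axis (R : realType) n (X : set 'rV[R]_n) : set 'rV[R]_n :=
  [set x | ~ X x /\
    exists y z, [/\ closest_points X x y, closest_points X x z & y <> z]].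

(* The empty germ does not count as connected. *)
Definition connected_germ (T : topologicalType) (A : set T) (p : T) :=
  forall V, nbhs p V ->
  exists U, [/\ nbhs p U, U `<=` V, A `&` U !=set0 & connected (A `&` U)].

(* f is continuously differentiable on [0, e) with derivative f'; the
   derivative at 0 is one-sided. *)
Definition C1_on (R : realType) (e : R) (f f' : R -> R) :=
  {within `[0, e[, continuous f'} /\
  forall t, t \in `[0, e[ ->
    (f s - f t) / (s - t) @[s --> within `[0, e[ (t^')] --> f' t.

(* In the orthonormal coordinates x *m U, the set X is, near 0, the graph of f
   on [0, e), whose tangent at 0 is the half-line [0, +oo) x {0}. *)
Definition branch_at0 (R : realType) (S : ominimal_structure R)
    (X : set 'rV[R]_2) (U : 'M[R]_2) (e : R) (f : R -> R) :=
  [/\ U *m U^T = 1%:M, 0 < e,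
      definable S (graph_on `[0, e[ f),
      \forall x \near (0 : 'rV[R]_2), X x <-> graph_on `[0, e[ f (x *m U)
    & f 0 = 0 /\ exists2 f', C1_on e f f' & f' 0 = 0].

Definition superquadratic_at0 (R : realType) (S : ominimal_structure R)
    (X : set 'rV[R]_2) :=
  exists U e f, [/\ branch_at0 S X U e f,
    ~ (\forall t \near 0^'+, f t = 0)
  & exists a alpha : R, [/\ a != 0, 1 <= alpha,
      (fun t => f t - a * t `^ alpha) =o_ (0^'+) (fun t => t `^ alpha)
    & alpha < 2]].

(* Main.v *)
Require Import Defs.
From mathcomp Require Import all_boot all_order all_algebra.
From mathcomp Require Import all_classical all_reals all_analysis.
From mathcomp Require Import ring lra.
Import Order.TTheory GRing.Theory Num.Theory.
Import numFieldNormedType.Exports.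
Local Open Scope classical_set_scope.
Local Open Scope ring_scope.

(** The squared distance from a point to a graph decides everything.

Suppose that X is, near 0, the graph of f over [[0, e)], with f(t) ~ a t^alpha, a > 0 and
alpha < 2. Then t^2 = o(f(t)). For small s > 0 the function
psi(t) = (2 s f(t) - t^2 - f(t)^2) / (2 t) is therefore positive somewhere, while
psi(0+) = 0 since f'(0) = 0. If c is the maximum of psi, attained at t > 0, then the origin and
(t, f(t)) are both closest points of X to (-c, s). This point of the medial
axis tends to 0 with s ([medial_axis_graph], [superquadratic_medial_axis]).

Conversely, let 0 be in the closure of the medial axis. O-minimality shows that X
is near 0 the graph of a definable function f of class C^1, with f(0) = f'(0) = 0
([branch_exists]), and that f'' has a limit at 0+ in the extended line. If the limit were
finite, the squared distance to a point near 0 would be strictly convex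
along the graph, and there would be no medial axis near 0 ([no_medial_axis_graph]).
So |f(t)| / t^2 tends to infinity, and f(t) ~ a t^alpha forces
alpha < 2 ([steep_power_asymptotics]). The expansion itself is where polynomial boundedness
enters. The function t f'(t) / f(t) has a limit alpha, and its difference to alpha, like any
definable function tending to 0, is O(t^delta) for some delta > 0
([germ_polynomial_decay]). Hence the derivative of ln(f(t) / t^alpha) is integrable at 0, and
f(t) / t^alpha has a positive limit ([germ_power_asymptotics]).

The facts on definable germs rest on a dichotomy: a definable subset
of the line contains or misses a right neighbourhood of 0 ([def_set_dicho]). Applied to
the definable set of points at which a function has some local behaviour, it makes
this behaviour the same at all points near 0. Behaviours that cannot occur at all
points of an interval, such as strict local minima or infinite derivatives, are ruled out
by countability and mean value arguments. This gives monotonicity, continuity and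
differentiability ([germ_monotone], [germ_continuous], [germ_derivable]).

For the curve, a cluster point of the directions of its points is a tangent
direction. In the rotated frame, f(a) is a point of the fibre over a that is
closest to the axis. Since X has no interior points, f(a) is isolated in its fibre by a
gap that is definable in a, hence continuous and positive ([isolated_selection]). The graph
is then open and closed in X without the origin, near 0, and the connected germ lies
in it ([germ_in_graph]). *)

Set Implicit Arguments.
Unset Strict Implicit.

(** * Definability by syntax *)

Section Calculus.
Variables (R : realType) (S : ominimal_structure R).
Implicit Types (P Q : (nat -> R) -> Prop) (t : (nat -> R) -> R).

Definition coords n (r : nat -> R) : 'rV[R]_n := \row_(i < n) r i.

(** Formulas are predicates on environments, infinite sequences of values for the
variables; only the first [n] variables may matter. This keeps all contexts in
one type, so that quantifiers and renamings need no dimension arithmetic. *)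
Definition defn n P :=
  exists2 A : set 'rV[R]_n, definable S A & forall r, P r <-> A (coords n r).

Definition def_pred P := exists n, defn n P.

(** A term is definable when its graph is: the value is variable 0, and the
variables of the term are shifted by one. *)
Definition def_term t := def_pred (fun r => r 0 = t (fun i => r i.+1)).

Lemma defn_ext n P Q : (forall r, P r <-> Q r) -> defn n P -> defn n Q.
Proof. by move=> PQ [A dA PA]; exists A => // r; rewrite -PQ. Qed.

Lemma def_pred_ext P Q : (forall r, P r <-> Q r) -> def_pred P -> def_pred Q.
Proof. by move=> PQ [n dP]; exists n; apply: defn_ext dP. Qed.

Lemma defn_local n P r r' :
  defn n P -> (forall i, (i < n)%N -> r i = r' i) -> P r -> P r'.
Proof.
move=> [A _ PA] rr' /PA Ar; apply/PA; rewrite (_ : coords n r' = coords n r)//.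
by apply/rowP => i; rewrite !mxE rr'.
Qed.

Lemma defnS n P : defn n P -> defn n.+1 P.
Proof.
move=> [A dA PA]; rewrite -addn1; exists [set x | A (lsubmx x)].
  exact: definable_prodr.
move=> r; rewrite PA /=; suff -> : lsubmx (coords (n + 1) r) = coords n r by [].
by apply/rowP => i; rewrite !mxE.
Qed.

Lemma defn_le m n P : (m <= n)%N -> defn m P -> defn n P.
Proof.
move=> mn dP; rewrite -(subnK mn); elim: (n - m)%N => // k IH.
by rewrite addSn; exact: defnS.
Qed.

Lemma defn_shift n P : defn n P -> defn n.+1 (fun r => P (fun i => r i.+1)).
Proof.
move=> [A dA PA]; exists ([set x : 'rV_(1 + n) | A (rsubmx x)]).
  exact: definable_prodl.
move=> r; rewrite PA /=.
suff -> : rsubmx (coords (1 + n) r) = coords n (fun i => r i.+1) by [].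
by apply/rowP => i; rewrite !mxE.
Qed.

Lemma defn_shiftn m n P : defn n P -> defn (m + n) (fun r => P (fun i => r (m + i)%N)).
Proof.
elim: m P => [|m IH] P dP //; have := defn_shift (IH _ dP).
by apply: defn_ext => r.
Qed.

Lemma defn_proj n P : defn n.+1 P ->
  defn n (fun r => exists r', (forall i, (i < n)%N -> r' i = r i) /\ P r').
Proof.
rewrite -addn1 => -[A dA PA]; exists (lsubmx @` A); first exact: definable_proj.
move=> r; split=> [[r' [r'r Pr']]|[x Ax xr]].
  exists (coords (n + 1) r'); first exact/PA.
  by apply/rowP => i; rewrite !mxE /= r'r.
pose r' i := oapp (x 0) 0 (insub i : option 'I_(n + 1)).
have r'E : coords (n + 1) r' = x.
  by apply/rowP => i; rewrite !mxE /r' valK.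
exists r'; split; last by apply/PA; rewrite r'E.
move=> i ni; have /rowP/(_ (Ordinal ni)) := xr; rewrite !mxE /= => <-.
rewrite /r' insubT ?addn1 ?ltnS 1?ltnW// => lt /=.
by congr (x 0 _); apply/val_inj.
Qed.

Lemma defn_projn m n P : defn (n + m) P ->
  defn n (fun r => exists r', (forall i, (i < n)%N -> r' i = r i) /\ P r').
Proof.
elim: m n P => [|m IH] n P.
  rewrite addn0 => dP; apply: defn_ext (dP) => r; split.
    by move=> Pr; exists r.
  by move=> [r' [r'r Pr']]; apply: defn_local dP _ Pr'.
rewrite addnS -addSn => /IH /defn_proj; apply: defn_ext => r; split.
  move=> [r1 [r1r [r2 [r21 Pr2]]]]; exists r2; split=> // i ni.
  by rewrite r21 ?r1r// ltnW.
move=> [r1 [r1r Pr1]]; exists r1; split=> //; exists r1; split=> //.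
Qed.

Lemma defn_and n P Q : defn n P -> defn n Q -> defn n (fun r => P r /\ Q r).
Proof.
move=> [A dA PA] [B dB QB]; exists (~` (~` A `|` ~` B)).
  by apply: definable_setC; apply: definable_setU; apply: definable_setC.
by move=> r; rewrite PA QB setCU !setCK.
Qed.

Lemma defn_not n P : defn n P -> defn n (fun r => ~ P r).
Proof.
move=> [A dA PA]; exists (~` A); first exact: definable_setC.
by move=> r; rewrite PA.
Qed.

Lemma defn_true n : defn n (fun=> True).
Proof.
exists (~` set0); first by apply: definable_setC; apply: definable_set0.
by move=> r; split=> // _; apply.
Qed.

Lemma defn_forall_lt n k (P : nat -> (nat -> R) -> Prop) :
  (forall i, (i < k)%N -> defn n (P i)) ->
  defn n (fun r => forall i, (i < k)%N -> P i r).
Proof.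
elim: k => [|k IH] dP.
  by apply: defn_ext (defn_true n) => r; split.
have := defn_and (IH (fun i ik => dP i (ltnW ik))) (dP k (ltnSn k)).
apply: defn_ext => r; split=> [[Pr Pk] i|Pr].
  by rewrite ltnS leq_eqVlt => /predU1P[->//|/Pr].
by split=> [i ik|]; apply: Pr => //; apply: ltnW.
Qed.

Lemma defn_eqv n i j : (i < n)%N -> (j < n)%N -> defn n (fun r => r i = r j).
Proof.
move=> ni nj; exists [set x | x 0 (Ordinal ni) = x 0 (Ordinal nj)].
  exact: definable_diag.
by move=> r /=; rewrite !mxE.
Qed.

(** The structure only provides cylinders, diagonals and projections, and no
permutation of coordinates. Renaming is derived from them: [k] fresh variables are
appended after the first [n], equated with the variables they stand for, and
projected away. *)
Lemma defn_rename k n P (s : nat -> nat) :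
  (forall i, (i < k)%N -> (s i < n)%N) -> defn k P ->
  defn n (fun r => P (fun i => r (s i))).
Proof.
move=> sn dP.
have dE : defn (n + k) (fun r => forall i, (i < k)%N -> r (n + i)%N = r (s i)).
  apply: defn_forall_lt => i ik; apply: defn_eqv; first by rewrite ltn_add2l.
  by rewrite (leq_trans (sn _ ik))// leq_addr.
have := defn_projn (defn_and (defn_shiftn n dP) dE).
apply: defn_ext => r; split.
  move=> [r' [r'r [Pr' r's]]]; apply: (defn_local dP _ Pr') => i ik.
  by rewrite r's// r'r// sn.
move=> Pr; exists (fun i => if (i < n)%N then r i else r (s (i - n)%N)).
split=> [i ->//|]; split=> [|i ik].
  by apply: (defn_local dP _ Pr) => i ik; rewrite ltnNge leq_addr/= addKn.
by rewrite ltnNge leq_addr/= addKn sn.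
Qed.

Lemma def_rename P (s : nat -> nat) :
  def_pred P -> def_pred (fun r => P (fun i => r (s i))).
Proof.
move=> [k dP]; exists (\max_(i < k) (s i).+1)%N; apply: defn_rename dP => i ik.
exact: (leq_bigmax (Ordinal ik)).
Qed.

Lemma def_and P Q : def_pred P -> def_pred Q -> def_pred (fun r => P r /\ Q r).
Proof.
move=> [m dP] [n dQ]; exists (maxn m n).
by apply: defn_and; [apply: defn_le dP; rewrite leq_maxl|
  apply: defn_le dQ; rewrite leq_maxr].
Qed.

Lemma def_not P : def_pred P -> def_pred (fun r => ~ P r).
Proof. by move=> [n dP]; exists n; apply: defn_not. Qed.

Lemma def_or P Q : def_pred P -> def_pred Q -> def_pred (fun r => P r \/ Q r).
Proof.
move=> dP dQ; apply: def_pred_ext (def_not (def_and (def_not dP) (def_not dQ))).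
by move=> r; rewrite not_andP !notK.
Qed.

Lemma def_imp P Q : def_pred P -> def_pred Q -> def_pred (fun r => P r -> Q r).
Proof.
move=> dP dQ; apply: def_pred_ext (def_or (def_not dP) dQ) => r.
by split=> [[]//|PQ]; have [/PQ|] := pselect (P r); [right|left].
Qed.

(** The bound variable is variable 0 of the body; it is moved to the last place
before projecting, since only the last coordinate can be projected away. *)
Lemma def_ex (P : (nat -> R) -> R -> Prop) :
  def_pred (fun r => P (fun i => r i.+1) (r 0)) ->
  def_pred (fun r => exists y, P r y).
Proof.
move=> [n /defnS dP]; exists n.
pose s i := if i is j.+1 then j else n.
have sn i : (i < n.+1)%N -> (s i < n.+1)%N.
  by case: i => //= i /ltnW.
have := defn_proj (defn_rename sn dP); apply: defn_ext => r; split.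
  move=> [r' [r'r Pr']]; exists (r' n).
  pose c := fun i => if i is j.+1 then r j else r' n.
  apply: (defn_local dP (r := fun i => r' (s i)) (r' := c)) Pr'.
  by move=> [|i]//=; rewrite ltnS => /r'r.
move=> [y Py]; exists (fun i => if i == n then y else r i); split.
  by move=> i; case: eqP => // ->; rewrite ltnn.
pose c := fun i => if i is j.+1 then r j else y.
pose r1 i := if i == n then y else r i.
apply: (defn_local dP (r := c) (r' := fun i => r1 (s i))) Py => -[|i] /=.
  by rewrite /r1 eqxx.
by rewrite ltnS /r1 => ni; rewrite ltn_eqF.
Qed.

Lemma def_all (P : (nat -> R) -> R -> Prop) :
  def_pred (fun r => P (fun i => r i.+1) (r 0)) ->
  def_pred (fun r => forall y, P r y).
Proof.
move=> dP; have := def_not (def_ex (P := fun r y => ~ P r y) (def_not dP)).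
apply: def_pred_ext => r; rewrite -forallNE; split=> Pr y.
  by apply: contrapT; exact: Pr.
by apply; exact: Pr.
Qed.

Definition def_set (Q : R -> Prop) := def_pred (fun r => Q (r 0)).
Definition def_rel (Q : R -> R -> Prop) := def_pred (fun r => Q (r 0) (r 1)).
Definition def_fun (f : R -> R) := def_pred (fun r => r 0 = f (r 1)).
Definition def_op (f : R -> R -> R) :=
  def_pred (fun r => r 0 = f (r 1) (r 2)).

(** Substituting a term [t] in [Q] is [exists y, y = t /\ Q y]. *)
Lemma def_pred1 (Q : R -> Prop) t :
  def_set Q -> def_term t -> def_pred (fun r => Q (t r)).
Proof.
move=> dQ dt; have := def_ex (P := fun r y => y = t r /\ Q y) (def_and dt dQ).
by apply: def_pred_ext => r; split=> [[y [-> //]]|Qt]; exists (t r).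
Qed.

Lemma def_term_shift t : def_term t -> def_pred (fun r => r 1 = t (fun i => r i.+2)).
Proof. by move=> /(def_rename (fun i => i.+1)). Qed.

Lemma def_pred2 (Q : R -> R -> Prop) t u :
  def_rel Q -> def_term t -> def_term u -> def_pred (fun r => Q (t r) (u r)).
Proof.
move=> dQ dt du.
have du' : def_pred (fun r => r 0 = u (fun i => r i.+2)).
  exact: (def_rename (fun i => if i is j.+1 then j.+2 else 0) du).
have dQ' : def_pred (fun r => Q (r 1) (r 0)).
  exact: (def_rename (fun i => if i is 0 then 1 else 0) dQ).
have := def_ex (P := fun r y => exists z, y = t r /\ z = u r /\ Q y z)
  (def_ex (P := fun r z => r 0 = t (fun i => r i.+1) /\
     z = u (fun i => r i.+1) /\ Q (r 0) z)
   (def_and (def_term_shift dt) (def_and du' dQ'))).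
apply: def_pred_ext => r; split=> [[y [z [-> [-> //]]]]|Qt].
by exists (t r), (u r).
Qed.

Lemma def_term1 f t : def_fun f -> def_term t -> def_term (fun r => f (t r)).
Proof.
move=> df dt; have df' : def_pred (fun r => r 1 = f (r 0)).
  exact: (def_rename (fun i => if i is 0 then 1 else 0) df).
have df2 := def_pred2 (Q := fun x y => y = f x) df'.
have dt' : def_term (fun r => t (fun i => r i.+1)).
  exact: (def_rename (fun i => if i is j.+1 then j.+2 else 0) dt).
apply: (df2 (fun r => t (fun i => r i.+1)) (fun r => r 0)) => //.
exact: (@def_rename (fun r => r 0 = r 1) id (ex_intro _ 2 (defn_eqv (ltn0Sn 1) (ltnSn 1)))).
Qed.

Lemma def_term2 f t u : def_op f -> def_term t -> def_term u ->
  def_term (fun r => f (t r) (u r)).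
Proof.
move=> df dt du.
have dt' : def_pred (fun r => r 1 = t (fun i => r i.+3)).
  exact: (def_rename (fun i => if i is j.+1 then j.+3 else 1) dt).
have du' : def_pred (fun r => r 0 = u (fun i => r i.+3)).
  exact: (def_rename (fun i => if i is j.+1 then j.+3 else 0) du).
have df' : def_pred (fun r => r 2 = f (r 1) (r 0)).
  exact: (def_rename (fun i => if i is 0 then 2 else if i is 1 then 1 else 0) df).
have := def_ex (P := fun r y => exists z, y = t (fun i => r i.+1) /\
   z = u (fun i => r i.+1) /\ r 0 = f y z)
  (def_ex (P := fun r z => r 0 = t (fun i => r i.+2) /\
     z = u (fun i => r i.+2) /\ r 1 = f (r 0) z)
   (def_and dt' (def_and du' df'))).
apply: def_pred_ext => r; split=> [[y [z [-> [-> //]]]]|Qt].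
by exists (t (fun i => r i.+1)), (u (fun i => r i.+1)).
Qed.

Lemma def_var i : def_term (fun r => r i).
Proof.
rewrite /def_term; exists i.+2; exact: defn_eqv.
Qed.

Lemma def_cst c : def_term (fun=> c).
Proof.
exists 1; exists [set x : 'rV[R]_1 | x 0 0 = c].
  apply/definable_line; exists [:: `[c, c] ]; apply/funext => x; apply/propext.
  split=> [/= xc|/= [i]]; first by exists `[c, c]; [rewrite mem_seq1|rewrite in_itv/= xc lexx].
  by move=> ii + /=; move: ii; rewrite mem_seq1 => /eqP ->; rewrite in_itv/= -eq_le => /eqP.
by move=> r /=; rewrite mxE.
Qed.

Lemma def_eq t u : def_term t -> def_term u -> def_pred (fun r => t r = u r).
Proof.
apply: (@def_pred2 (fun x y => x = y)).
by exists 2; exact: defn_eqv.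
Qed.

Lemma def_opD : def_op (fun x y => x + y).
Proof.
have dD : def_pred (fun r => r 0 + r 1 = r 2).
  exists 3; exists [set x : 'rV[R]_3 | x 0 0 + x 0 1 = x 0 ord_max].
    exact: definable_add.
  by move=> r /=; rewrite !mxE.
have := def_rename (fun i => match i with 0 => 1 | 1 => 2 | _ => 0 end)%N dD.
by apply: def_pred_ext => r.
Qed.

Lemma def_opM : def_op (fun x y => x * y).
Proof.
have dD : def_pred (fun r => r 0 * r 1 = r 2).
  exists 3; exists [set x : 'rV[R]_3 | x 0 0 * x 0 1 = x 0 ord_max].
    exact: definable_mul.
  by move=> r /=; rewrite !mxE.
have := def_rename (fun i => match i with 0 => 1 | 1 => 2 | _ => 0 end)%N dD.
by apply: def_pred_ext => r.
Qed.

Lemma def_add t u : def_term t -> def_term u -> def_term (fun r => t r + u r).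
Proof. exact: (def_term2 def_opD). Qed.

Lemma def_mul t u : def_term t -> def_term u -> def_term (fun r => t r * u r).
Proof. exact: (def_term2 def_opM). Qed.

Lemma def_opp t : def_term t -> def_term (fun r => - t r).
Proof.
move=> dt; apply: (@def_term1 (fun x => - x)) => //.
have := def_eq (def_add (def_var 0) (def_var 1)) (def_cst 0).
by apply: def_pred_ext => r; split=> [/eqP|->]; rewrite ?addNr// addr_eq0 => /eqP.
Qed.

(** In a real closed field, [x <= y] means that [y - x] is a square. *)
Lemma def_le t u : def_term t -> def_term u -> def_pred (fun r => t r <= u r).
Proof.
apply: (@def_pred2 (fun x y => x <= y)).
have := def_ex (P := fun r z => r 0 + z * z = r 1)
  (def_eq (def_add (def_var 1) (def_mul (def_var 0) (def_var 0))) (def_var 2)).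
apply: def_pred_ext => r; split=> [[y <-]|le01].
  by rewrite lerDl -expr2 sqr_ge0.
exists (Num.sqrt (r 1 - r 0)); rewrite -expr2 sqr_sqrtr ?subr_ge0//.
by rewrite addrC subrK.
Qed.

Lemma def_lt t u : def_term t -> def_term u -> def_pred (fun r => t r < u r).
Proof.
move=> dt du; apply: def_pred_ext (def_not (def_le du dt)) => r.
by rewrite ltNge; split=> [/negP|/negP].
Qed.

Lemma def_inv t : def_term t -> def_term (fun r => (t r)^-1).
Proof.
apply: (@def_term1 (fun x => x^-1)).
have d0 := def_and (def_eq (def_var 1) (def_cst 0)) (def_eq (def_var 0) (def_cst 0)).
have d1 := def_eq (def_mul (def_var 0) (def_var 1)) (def_cst 1).
apply: def_pred_ext (def_or d0 d1) => r; split=> [[[-> ->]|r01]|->].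
- by rewrite invr0.
- have r1 : r 1 != 0 by apply: contra_eq_neq r01 => ->; rewrite mulr0 eq_sym oner_eq0.
  by rewrite -[LHS](mulfK r1) r01 mul1r.
- by have [->|r1] := eqVneq (r 1) 0; [left; rewrite invr0|right; rewrite mulVf].
Qed.

Lemma def_norm t : def_term t -> def_term (fun r => `|t r|).
Proof.
apply: (@def_term1 (fun x => `|x|)).
have d0 := def_le (def_cst 0) (def_var 0).
have d1 := def_or (def_eq (def_var 0) (def_var 1))
  (def_eq (def_var 0) (def_opp (def_var 1))).
apply: def_pred_ext (def_and d0 d1) => r; split=> [[r0 [r1|r1]]|->].
- by rewrite -r1 ger0_norm.
- by rewrite -normrN -r1 ger0_norm.
- split=> //; have [?|?] := leP 0 (r 1); first by left; rewrite ger0_norm.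
  by right; rewrite ltr0_norm.
Qed.

(** Germs at 0+ are first-order, so `for all small h > 0' can be used as a
quantifier in definable formulas. *)
Lemma def_near0 (P : (nat -> R) -> R -> Prop) :
  def_pred (fun r => P (fun i => r i.+1) (r 0)) ->
  def_pred (fun r => \forall h \near 0^'+, P r h).
Proof.
move=> dP.
have := def_ex (P := fun r d => 0 < d /\ forall h, 0 < h -> h < d -> P r h)
  (def_and (def_lt (def_cst 0) (def_var 0))
   (def_all (P := fun r h => 0 < h -> h < r 0 -> P (fun i => r i.+1) h)
     (def_imp (def_lt (def_cst 0) (def_var 0)) (def_imp (def_lt (def_var 0) (def_var 1))
       (def_rename (fun i => if i is j.+1 then j.+2 else 0) dP))))).
apply: def_pred_ext => r; split=> [[d [d0 dP']]|].
  near=> h; apply: dP'; near: h; last exact: nbhs_right_lt.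
  exact: nbhs_right_gt.
case=> e /= e0 eP; exists e; split=> // h h0 he; apply: eP => //=.
by rewrite sub0r normrN gtr0_norm.
Unshelve. all: by end_near.
Qed.

(** A functional definable relation yields a total definable function, with
value 0 where the relation has no solution. Infima, right derivatives and
similar operators become definable terms in this way. *)
Lemma def_xget (P : (nat -> R) -> R -> Prop) :
  (forall r y z, P r y -> P r z -> y = z) ->
  def_pred (fun r => P (fun i => r i.+1) (r 0)) ->
  def_term (fun r => xget 0 [set y | P r y]).
Proof.
move=> Pfun dP.
have dN := def_not (def_ex (P := fun r y => P (fun i => r i.+1) y)
  (def_rename (fun i => if i is j.+1 then j.+2 else 0) dP)).
have := def_or dP (def_and dN (def_eq (def_var 0) (def_cst 0))).
apply: def_pred_ext => r; case: xgetP => [y -> /= Py|noP].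
  split=> [[Pr|[nP _]]|->]; [exact: Pfun Pr Py|by case: nP; exact: ex_intro Py|by left].
split=> [[/noP//|[_ ->//]]|->]; right; split=> // -[y]; exact: noP.
Qed.

End Calculus.

(** Definability of a concrete formula follows its syntax. The case of an
implication comes before that of a universal quantifier, whose pattern it also
matches. *)
Ltac def_step := cbv beta; match goal with
  | H : ?G |- ?G => exact H
  | |- def_term _ (fun r => r ?i) => exact (def_var _ i)
  | |- def_term _ (fun _ => ?c) => exact (def_cst _ c)
  | |- def_term _ (fun r => _ + _) => apply: def_add
  | |- def_term _ (fun r => _ * _) => apply: def_mul
  | |- def_term _ (fun r => - _) => apply: def_opp
  | |- def_term _ (fun r => _^-1) => apply: def_inv
  | |- def_term _ (fun r => `|_|) => apply: def_norm
  | H : def_fun _ ?f |- def_term _ (fun r => ?f _) => apply: (def_term1 H)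
  | |- def_set _ _ => rewrite /def_set
  | |- def_rel _ _ => rewrite /def_rel
  | |- def_pred _ (fun r => _ /\ _) => apply: def_and
  | |- def_pred _ (fun r => _ \/ _) => apply: def_or
  | |- def_pred _ (fun r => ~ _) => apply: def_not
  | |- def_pred _ (fun r => exists x, _) => apply: def_ex
  | |- def_pred _ (fun r => @prop_near1 _ _ _ _ _) => apply: def_near0
  | |- def_pred _ (fun r => is_true (_ <= _)) => apply: def_le
  | |- def_pred _ (fun r => is_true (_ < _)) => apply: def_lt
  | |- def_pred _ (fun r => _ = _) => apply: def_eq
  | H : def_set _ ?Q |- def_pred _ (fun r => ?Q _) => apply: (def_pred1 H)
  | H : def_rel _ ?Q |- def_pred _ (fun r => ?Q _ _) => apply: (def_pred2 H)
  | |- def_pred _ (fun r => _ -> _) => apply: def_imp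
  | |- def_pred _ (fun r => forall x, _) => apply: def_all
  end.
Ltac definability := repeat def_step.

(** * Right germs and the dichotomy for definable sets of reals *)

(** Linear arithmetic from the listed hypotheses: in a large context the search
over all of them is slow. *)
Tactic Notation "lra_from" hyp_list(hs) := clear - hs; lra.

Section RightGerm.
Variable R : realType.
Implicit Types (P Q : R -> Prop) (f : R -> R).

Lemma near0P P : (\forall h \near 0^'+, P h) <->
  exists2 d, 0 < d & forall h, 0 < h -> h < d -> P h.
Proof.
split=> [[d /= d0 dP]|[d d0 dP]].
  by exists d => // h h0 hd; apply: dP => //=; rewrite sub0r normrN gtr0_norm.
near=> h; apply: dP; near: h; [exact: nbhs_right_gt|exact: nbhs_right_lt].
Unshelve. all: by end_near. Qed.

Lemma near0_ex P d : 0 < d -> (\forall h \near 0^'+, P h) ->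
  exists h, [/\ 0 < h, h < d & P h].
Proof.
move=> d0 /near0P[e e0 eP]; exists (Num.min d e / 2).
have m0 : 0 < Num.min d e by rewrite lt_min d0.
have m2 : Num.min d e / 2 < Num.min d e by rewrite ltr_pdivrMr// mulr_natr mulr2n ltrDl.
split; first by rewrite divr_gt0.
  by rewrite (lt_le_trans m2)// ge_min lexx.
by apply: eP; rewrite ?divr_gt0// (lt_le_trans m2)// ge_min lexx orbT.
Qed.

(** Induction along a segment: the supremum of the initial segments on which
[P] holds can only be [b]. *)
Lemma real_induction P (a b : R) : P a ->
  (forall t, a <= t -> t < b -> (forall s, a <= s -> s <= t -> P s) ->
     \forall h \near 0^'+, P (t + h)) ->
  (forall t, a < t -> t <= b -> (forall s, a <= s -> s < t -> P s) -> P t) ->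
  forall t, a <= t -> t <= b -> P t.
Proof.
move=> Pa Pr Pl t at_ tb.
pose E := [set z | a <= z /\ z <= b /\ forall s, a <= s -> s <= z -> P s].
have ab : a <= b := le_trans at_ tb.
have Ea : E a.
  by split=> //; split=> // s sa sa'; have -> // : s = a by apply/le_anti/andP.
have Eub : has_ubound E by exists b => z [_ []].
set c := sup E.
have ac : a <= c by apply: ub_le_sup.
have cb : c <= b by apply: ge_sup; [exists a|move=> z [_ []]].
have below s : a <= s -> s < c -> P s.
  move=> sa sc; have c0 : 0 < c - s by rewrite subr_gt0.
  have [z [_ [_ Pz]]] := sup_adherent c0 (conj (ex_intro _ a Ea) Eub).
  by rewrite opprB addrC subrK => sz; apply: Pz => //; exact: ltW.
have Pc : P c.
  move: ac; rewrite le_eqVlt => /predU1P[<-//|ac]; exact: Pl.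
have upto s : a <= s -> s <= c -> P s.
  by move=> sa; rewrite le_eqVlt => /predU1P[->//|]; exact: below.
have [tc|ct] := leP t c; first exact: upto.
have cb' : c < b := lt_le_trans ct tb.
have /near0P[e e0 eP] := Pr c ac cb' upto.
set m := Num.min (e / 2) (b - c).
have m0 : 0 < m by rewrite lt_min divr_gt0//= subr_gt0.
have me : m < e.
  by rewrite gt_min ltr_pdivrMr// mulr_natr mulr2n ltrDl e0.
have Em : E (c + m).
  split; first by rewrite (le_trans ac)// lerDl ltW.
  split; first by rewrite -lerBrDl ge_min lexx orbT.
  move=> s sa sm; have [sc|cs] := leP s c; first exact: upto.
  rewrite -(subrK c s) addrC; apply: eP; first by rewrite subr_gt0.
  by rewrite (le_lt_trans _ me)// lerBlDl.
have := ub_le_sup Eub Em; rewrite -/c gerDl leNgt m0//.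
Qed.

(** A transitive comparison between values at nearby points, on both sides of
every point, propagates along the interval. *)
Lemma local_to_global (r : R -> R -> Prop) f (d : R) :
  (forall x y z, r x y -> r y z -> r x z) ->
  (forall t, 0 < t -> t < d -> \forall h \near 0^'+, r (f t) (f (t + h))) ->
  (forall t, 0 < t -> t < d -> \forall h \near 0^'+, r (f (t - h)) (f t)) ->
  forall x y, 0 < x -> x < y -> y < d -> r (f x) (f y).
Proof.
move=> rtr rR rL x y x0 xy yd.
suff : y = x \/ r (f x) (f y) by case=> // yx; rewrite yx ltxx in xy.
apply: (real_induction (P := fun s => s = x \/ r (f x) (f s)) (a := x) (b := y)) => //;
  [by left| | |exact: ltW].
- move=> t xt ty Pt; have t0 := lt_le_trans x0 xt.
  apply: filterS (rR t t0 (lt_trans ty yd)) => h rth; right.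
  by have [<-//|rxt] := Pt t xt (lexx _); apply: rtr rth.
- move=> t xt ty Pt; right; have t0 := lt_trans x0 xt.
  have xt0 : 0 < t - x by rewrite subr_gt0.
  have [h [h0 hx rh]] := near0_ex xt0 (rL t t0 (le_lt_trans ty yd)).
  have := Pt (t - h); rewrite gtrBl h0 => /(_ _ isT)[|<-//|rxt].
    by rewrite lerBrDl addrC -lerBrDl ltW// .
  exact: rtr rh.
Qed.

(** A mean value inequality under a one-sided hypothesis: a continuous function
that does not decrease just to the right of any point does not decrease. *)
Lemma mean_value_right f (a b : R) :
  (forall t, a < t -> t <= b -> {for t, continuous f}) ->
  (forall t, a <= t -> t < b -> \forall h \near 0^'+, f t <= f (t + h)) ->
  forall t, a <= t -> t <= b -> f a <= f t.
Proof.
move=> cf fR; apply: real_induction => //.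
- move=> t xt ty Pt; apply: filterS (fR t xt ty) => h; apply: le_trans; exact: Pt.
- move=> t xt ty Pt; have ct := cf t xt ty.
  rewrite leNgt; apply/negP => ft.
  have : \forall s \near t, f s < f a by exact: (cvgr_lt _ ct).
  move=> [e /= e0 eP].
  pose h := Num.min (e / 2) (t - a).
  have h0 : 0 < h by rewrite lt_min divr_gt0//= subr_gt0.
  have he : h < e.
    by rewrite gt_min ltr_pdivrMr// mulr_natr mulr2n ltrDl e0.
  have /= := eP (t - h); rewrite opprB addrC subrK gtr0_norm// => /(_ he).
  rewrite ltNge Pt//; last by rewrite gtrBl.
  by rewrite lerBrDl addrC -lerBrDl ge_min lexx orbT.
Qed.

(** The points that are strict minima within distance 1/(n+1) form a finite
set for each [n], so there are only countably many strict local minima; but an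
interval is uncountable. *)
Lemma no_strict_local_min f (d : R) : 0 < d ->
  (forall n, finite_set [set t | 0 < t /\ t < d /\
     forall h, 0 < h -> h < n.+1%:R^-1 -> f t < f (t + h) /\ f t < f (t - h)]) ->
  ~ (forall t, 0 < t -> t < d -> \forall h \near 0^'+, f t < f (t + h) /\ f t < f (t - h)).
Proof.
move=> d0; pose A n := [set t | 0 < t /\ t < d /\
     forall h, 0 < h -> h < n.+1%:R^-1 -> f t < f (t + h) /\ f t < f (t - h)].
move=> finA minf.
have : countable `]0, d[%classic.
  apply: (@sub_countable _ _ _ (\bigcup_n A n)).
    apply: subset_card_le => t /=; rewrite in_itv/= => /andP[t0 td].
    have /near0P[e e0 eP] := minf t t0 td.
    pose n := Num.trunc e^-1; exists n => //; split=> //; split=> // h h0 hn.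
    apply: eP => //; apply: lt_trans hn _; rewrite invf_plt ?posrE//.
    exact: truncnS_gt.
  by apply: bigcup_countable => // n _; apply: finite_set_countable; exact: finA.
move=> /countable_lebesgue_measure0; rewrite lebesgue_measure_itv/= lte_fin d0.
by rewrite oppr0 adde0 => /eqP; rewrite eqe gt_eqF.
Qed.

End RightGerm.

Section Dichotomy.
Variables (R : realType) (S : ominimal_structure R).
Implicit Types (P Q : R -> Prop) (f : R -> R).

Lemma def_set_itv Q : def_set S Q ->
  exists s : seq (interval R), forall x, Q x <-> exists2 i, i \in s & x \in i.
Proof.
case=> n /(defn_le (leq_addl 1 n)) /defn_projn[A dA QA].
have [s sA] := (definable_line S A).1 dA; exists s => x.
transitivity (A (coords 1 (fun=> x))); last by rewrite sA /= mxE.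
rewrite -QA; split=> [Qx|[r [r0]]]; first by exists (fun=> x).
by rewrite r0.
Qed.

Lemma itv_dicho (i : interval R) :
  (\forall h \near 0^'+, h \in i) \/ (\forall h \near 0^'+, h \notin i).
Proof.
case: i => l r.
have dl : (\forall h \near 0^'+, (l <= BLeft h)%O) \/
          (\forall h \near 0^'+, ~~ (l <= BLeft h)%O).
  case: l => [b c|b]; last first.
    by case: b; [left|right]; near=> h.
  have [c0|c0] := leP c 0.
    left; near=> h; have h0 : 0 < h by near: h; exact: nbhs_right_gt.
    by case: b; rewrite bnd_simp ?ltW// (le_lt_trans c0).
  right; near=> h; have h0 : h < c by near: h; exact: nbhs_right_lt.
  by case: b; rewrite bnd_simp -?ltNge -?leNgt// ltW.
have dr : (\forall h \near 0^'+, (BRight h <= r)%O) \/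
          (\forall h \near 0^'+, ~~ (BRight h <= r)%O).
  case: r => [b c|b]; last first.
    by case: b; [right|left]; near=> h.
  have [c0|c0] := leP c 0.
    right; near=> h; have h0 : 0 < h by near: h; exact: nbhs_right_gt.
    by case: b; rewrite bnd_simp -?ltNge -?leNgt ?(le_lt_trans c0)// ltW// (le_lt_trans c0).
  left; near=> h; have h0 : h < c by near: h; exact: nbhs_right_lt.
  by case: b; rewrite bnd_simp ?ltW.
case: dl => dl; last by right; near do rewrite itv_boundlr negb_and; apply: filterS dl => h ->.
case: dr => dr; last by right; apply: filterS dr => h; rewrite itv_boundlr negb_and => ->; rewrite orbT.
by left; apply: filterS2 dl dr => h; rewrite itv_boundlr => -> ->.
Unshelve. all: by end_near. Qed.

(** A finite union of intervals contains or misses a right neighbourhood of 0.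
This makes every definable condition constant near 0. *)
Lemma def_set_dicho Q : def_set S Q ->
  (\forall h \near 0^'+, Q h) \/ (\forall h \near 0^'+, ~ Q h).
Proof.
move=> /def_set_itv[s sQ].
suff : (\forall h \near 0^'+, exists2 i, i \in s & h \in i) \/
   (\forall h \near 0^'+, ~ exists2 i, i \in s & h \in i).
  by case=> H; [left|right]; apply: filterS H => h; rewrite sQ.
elim: s {sQ} => [|i s [IH|IH]]; first by right; near=> h; case.
  by left; apply: filterS IH => h [j js hj]; exists j => //; rewrite inE js orbT.
have [hi|hi] := itv_dicho i.
  by left; apply: filterS hi => h hi; exists i => //; rewrite inE eqxx.
right; apply: filterS2 hi IH => h hi hs [j]; rewrite inE => /predU1P[->|js hj].
  by apply/negP.
by apply: hs; exists j.
Unshelve. all: by end_near. Qed.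

(** What happens for arbitrarily small [h > 0] happens for all small [h]. *)
Lemma def_set_freq Q : def_set S Q -> ~ (\forall h \near 0^'+, ~ Q h) ->
  \forall h \near 0^'+, Q h.
Proof. by move=> /def_set_dicho[]. Qed.

Lemma def_set_or P Q : def_set S P -> (\forall h \near 0^'+, P h \/ Q h) ->
  (\forall h \near 0^'+, P h) \/ (\forall h \near 0^'+, Q h).
Proof.
move=> /def_set_dicho[|nP] PQ; first by left.
by right; apply: filterS2 nP PQ => h nP [].
Qed.

(** Each of the finitely many intervals is a point, is empty, or has two
distinct points. *)
Lemma def_set_finite_or_itv Q : def_set S Q -> finite_set [set x | Q x] \/
  exists a b, a < b /\ forall x, a < x -> x < b -> Q x.
Proof.
move=> /def_set_itv[s sQ].
have -> : [set x | Q x] = [set x | exists2 i, i \in s & x \in i].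
  by apply/funext => x; apply/propext; exact: sQ.
have : finite_set [set x | exists2 i, i \in s & x \in i] \/ exists a b, a < b /\
    forall x, a < x -> x < b -> exists2 i, i \in s & x \in i.
  elim: s {sQ} => [|i s [IH|[a [b [ab IH]]]]].
  - by left; apply: (sub_finite_set _ (finite_set0 _)) => x [].
  - have [[x [y [xi yi xy]]]|/forallNP ni] :=
      pselect (exists x y, [/\ x \in i, y \in i & x < y]).
      right; exists x, y; split=> // z xz zy; exists i; first by rewrite inE eqxx.
      by apply: (interval_is_interval xi yi); rewrite !ltW.
    left; apply: (@sub_finite_set _ _ ([set` i] `|` [set x | exists2 i, i \in s & x \in i])).
      move=> x [j]; rewrite inE => /predU1P[->|js] xj; [by left|by right; exists j].
    rewrite finite_setU; split=> //.
    have [->|/set0P[x xi]] := eqVneq [set` i] set0; first exact: finite_set0.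
    apply: (sub_finite_set _ (finite_set1 x)) => y yi /=.
    have [yx|xy|//] := ltgtP y x.
      by case: (ni y); exists x.
    by case: (ni x); exists y.
  - right; exists a, b; split=> // x ax xb; have [j js xj] := IH x ax xb.
    by exists j => //; rewrite inE js orbT.
case=> [fin|[a [b [ab H]]]]; [by left|right].
by exists a, b; split=> // x ax xb; apply/sQ; exact: H.
Qed.

End Dichotomy.

(** * Monotonicity of definable germs *)

Section Monotonicity.
Variables (R : realType) (S : ominimal_structure R).
Implicit Types (P Q : R -> Prop) (f u : R -> R).

Lemma def_fun_opp f : def_fun S f -> def_fun S (fun x => - f x).
Proof. by move=> df; apply: (def_opp (t := fun r => f (r 0))); definability. Qed.

Lemma def_set_trichotomy u c : def_fun S u ->
  [\/ \forall h \near 0^'+, u h < c, \forall h \near 0^'+, u h = c |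
      \forall h \near 0^'+, c < u h].
Proof.
move=> du.
have [|nlt] : _ \/ _ := def_set_dicho (Q := fun h => u h < c) (S := S) ltac:(definability).
  by move=> ?; apply: Or31.
have [|neq] : _ \/ _ := def_set_dicho (Q := fun h => u h = c) (S := S) ltac:(definability).
  by move=> ?; apply: Or32.
apply: Or33; apply: filterS2 nlt neq => h; case: ltgtP => //.
Qed.

Definition rel_on (r : R -> R -> Prop) f d :=
  forall x y, 0 < x -> x < y -> y < d -> r (f x) (f y).

(** If all points near 0 were strict local minima, then some set of strict
minima within distance [c] would contain an interval; two of its points closer
than [c] would each have the smaller value. *)
Lemma germ_no_strict_local_min f : def_fun S f ->
  ~ (\forall t \near 0^'+, (\forall h \near 0^'+, f t < f (t + h)) /\
                           (\forall h \near 0^'+, f t < f (t - h))).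
Proof.
move=> df /near0P[d d0 dP].
apply: (@no_strict_local_min R f d d0) => [n|t t0 td]; last first.
  by have [H1 H2] := dP t t0 td; apply: filterS2 H1 H2.
set c : R := n.+1%:R^-1; have c0 : 0 < c by rewrite invr_gt0.
have [fin|[a [b [ab abA]]]] := def_set_finite_or_itv (S := S) (Q := fun t => 0 < t /\ t < d /\
     forall h, 0 < h -> h < c -> f t < f (t + h) /\ f t < f (t - h)) ltac:(definability).
  exact: fin.
pose x := (a + b) / 2; pose h := Num.min ((b - a) / 4) (c / 2).
have h0 : 0 < h by rewrite lt_min !divr_gt0// subr_gt0.
have hc : h < c by rewrite gt_min (_ : c / 2 < c) ?orbT//; lra.
have hb : h <= (b - a) / 4 by rewrite ge_min lexx.
have [_ [_ /(_ h h0 hc)[]]] : _ /\ _ /\ _ := abA x ltac:(rewrite /x; lra) ltac:(rewrite /x; lra).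
move=> lt1 _.
have [_ [_ /(_ h h0 hc)[_]]] : _ /\ _ /\ _ := abA (x + h) ltac:(rewrite /x; lra) ltac:(rewrite /x; lra).
by rewrite addrK => /(lt_trans lt1); rewrite ltxx.
Qed.

(** Each point [t] has a right type and a left type, according to whether [f] is
larger than, equal to or smaller than [f t] on that side. Types are definable
conditions, hence constant for small [t]. Of the nine combinations, equality
on one side only is impossible because the neighbours have equality on the other
side, and the two kinds of strict extrema are impossible by countability;
the three that remain integrate to monotonicity or constancy. *)
Lemma germ_monotone f : def_fun S f -> exists2 d, 0 < d &
  [\/ rel_on (fun x y => x < y) f d, rel_on (fun x y => y < x) f d | rel_on eq f d].
Proof.
move=> df.
pose r0 t := \forall h \near 0^'+, f t < f (t + h).
pose r1 t := \forall h \near 0^'+, f t = f (t + h).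
pose r2 t := \forall h \near 0^'+, f t > f (t + h).
pose l0 t := \forall h \near 0^'+, f (t - h) < f t.
pose l1 t := \forall h \near 0^'+, f (t - h) = f t.
pose l2 t := \forall h \near 0^'+, f (t - h) > f t.
have dr0 : def_set S r0 by rewrite /r0; definability.
have dr1 : def_set S r1 by rewrite /r1; definability.
have dl0 : def_set S l0 by rewrite /l0; definability.
have dl1 : def_set S l1 by rewrite /l1; definability.
have Rtri t : r0 t \/ (r1 t \/ r2 t).
  have du : def_fun S (fun h => f (t + h)) by rewrite /def_fun; definability.
  case: (def_set_trichotomy (f t) du) => H; [right; right|right; left|left] => //.
  by apply: filterS H => h ->.
have Ltri t : l0 t \/ (l1 t \/ l2 t).
  have du : def_fun S (fun h => f (t - h)) by rewrite /def_fun; definability.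
  by case: (def_set_trichotomy (f t) du) => H; [left|right; left|right; right].
have Rg : (\forall t \near 0^'+, r0 t) \/ ((\forall t \near 0^'+, r1 t) \/ (\forall t \near 0^'+, r2 t)).
  have [|H] := def_set_or dr0 (nearW _ Rtri); first by left.
  by right; exact: def_set_or dr1 H.
have Lg : (\forall t \near 0^'+, l0 t) \/ ((\forall t \near 0^'+, l1 t) \/ (\forall t \near 0^'+, l2 t)).
  have [|H] := def_set_or dl0 (nearW _ Ltri); first by left.
  by right; exact: def_set_or dl1 H.
have both (p q : R -> Prop) : (\forall t \near 0^'+, p t) -> (\forall t \near 0^'+, q t) ->
  exists2 d, 0 < d & forall t, 0 < t -> t < d -> p t /\ q t.
  move=> p0 q0; apply/near0P; exact: filterS2 p0 q0.
have eqL t d : 0 < t -> t < d -> r1 t -> exists t', [/\ 0 < t', t' < d & l1 t'].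
  move=> t0 td /near0P[e e0 eP].
  pose h := Num.min (e / 2) ((d - t) / 2).
  have h0 : 0 < h by rewrite lt_min !divr_gt0// subr_gt0.
  have he : h < e by rewrite gt_min (_ : e / 2 < e)//; lra.
  have hd : h <= (d - t) / 2 by rewrite ge_min lexx orbT.
  exists (t + h); split; [lra|lra|].
  near=> k; have k0 : 0 < k by near: k; exact: nbhs_right_gt.
  have kh : k < h by near: k; exact: nbhs_right_lt.
  by rewrite -addrA -!eP//; lra_from h0 he k0 kh.
have eqR t d : 0 < t -> t < d -> l1 t -> exists t', [/\ 0 < t', t' < d & r1 t'].
  move=> t0 td /near0P[e e0 eP].
  pose h := Num.min (e / 2) (t / 2).
  have h0 : 0 < h by rewrite lt_min !divr_gt0.
  have he : h < e by rewrite gt_min (_ : e / 2 < e)//; lra.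
  have hd : h <= t / 2 by rewrite ge_min lexx orbT.
  exists (t - h); split; [lra|lra|].
  near=> k; have k0 : 0 < k by near: k; exact: nbhs_right_gt.
  have kh : k < h by near: k; exact: nbhs_right_lt.
  by rewrite (_ : t - h + k = t - (h - k)); [rewrite !eP//; lra_from h0 he k0 kh|ring].
have clash t : l1 t -> l0 t \/ l2 t -> False.
  move=> l1t H; suff : \forall h \near (0 : R)^'+, False.
    by move=> /(near0_ex ltr01)[h []].
  by case: H => H; apply: filterS2 l1t H => h ->; rewrite ltxx.
have clash' t : r1 t -> r0 t \/ r2 t -> False.
  move=> l1t H; suff : \forall h \near (0 : R)^'+, False.
    by move=> /(near0_ex ltr01)[h []].
  by case: H => H; apply: filterS2 l1t H => h ->; rewrite ltxx.
(* Equality on the right at t gives equality on the left at points just after t. *)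
have noR1 : (\forall t \near 0^'+, r1 t) -> (\forall t \near 0^'+, l0 t \/ l2 t) -> False.
  move=> H1 H2; have [d d0 dP] := both _ _ H1 H2.
  have d2 : d / 2 < d by lra.
  have d20 : 0 < d / 2 by lra.
  have [t [t0 td l1t]] := eqL _ _ d20 d2 (dP _ d20 d2).1.
  exact: (clash _ l1t (dP _ t0 td).2).
have noL1 : (\forall t \near 0^'+, l1 t) -> (\forall t \near 0^'+, r0 t \/ r2 t) -> False.
  move=> H1 H2; have [d d0 dP] := both _ _ H1 H2.
  have d2 : d / 2 < d by lra.
  have d20 : 0 < d / 2 by lra.
  have [t [t0 td l1t]] := eqR _ _ d20 d2 (dP _ d20 d2).1.
  exact: (clash' _ l1t (dP _ t0 td).2).
case: Rg => [R0|[R1|R2]]; case: Lg => [L0|[L1|L2]].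
- have [d d0 dP] := both _ _ R0 L0; exists d => //; apply: Or31.
  by apply: local_to_global => [x y z|t t0 td|t t0 td];
    [exact: lt_trans|exact: (dP t t0 td).1|exact: (dP t t0 td).2].
- by case: noL1 => //; apply: filterS R0; left.
- case: (germ_no_strict_local_min df); exact: filterS2 R0 L2.
- by case: noR1 => //; apply: filterS L0; left.
- have [d d0 dP] := both _ _ R1 L1; exists d => //; apply: Or33.
  by apply: local_to_global => [x y z|t t0 td|t t0 td];
    [exact: etrans|exact: (dP t t0 td).1|exact: (dP t t0 td).2].
- by case: noR1 => //; apply: filterS L2; right.
- case: (germ_no_strict_local_min (def_fun_opp df)).
  apply: filterS2 R2 L0 => t rt lt; split; [apply: filterS rt|apply: filterS lt] => h;
  by rewrite ltrN2.
- by case: noL1 => //; apply: filterS R2; right.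
- have [d d0 dP] := both _ _ R2 L2; exists d => //; apply: Or32.
  apply: local_to_global => [x y z /= xy yz|t t0 td|t t0 td];
    [exact: lt_trans yz xy|exact: (dP t t0 td).1|exact: (dP t t0 td).2].
Unshelve. all: by end_near. Qed.

End Monotonicity.

(** * Continuity, limits and derivatives of definable germs *)

Section Regularity.
Variables (R : realType) (S : ominimal_structure R).
Implicit Types (P Q : R -> Prop) (f u : R -> R).

Lemma continuous_atP f (t : R) : {for t, continuous f} <->
  forall e : R, 0 < e -> exists d : R, 0 < d /\ forall s : R, `|s - t| < d -> `|f t - f s| < e.
Proof.
split=> [cf e e0|H].
  have /cvgrPdist_lt/(_ e e0)[d /= d0 dP] : f @ t --> f t := cf.
  by exists d; split=> // s sd; apply: dP; rewrite /= distrC.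
apply/cvgrPdist_lt => e e0; have [d [d0 dP]] := H e e0.
by exists d => //= s; rewrite /= distrC => /dP.
Qed.

(** The image of an increasing definable function is infinite, so it contains an
interval; a monotone function cannot jump where its values fill an interval. *)
Lemma incr_continuity_point f d : def_fun S f -> 0 < d ->
  rel_on (fun x y => x < y) f d ->
  exists t : R, [/\ 0 < t, t < d & {for t, continuous f}].
Proof.
move=> df d0 fI.
have [fin|[a [b [ab abQ]]]] := def_set_finite_or_itv (S := S)
  (Q := fun y => exists t, 0 < t /\ t < d /\ y = f t) ltac:(definability).
  have : countable `]0, d[%classic.
    apply: finite_set_countable.
    suff <- : finite_set (f @` `]0, d[) = finite_set `]0, d[.
      apply: sub_finite_set fin => y [t]; rewrite /= in_itv/= => /andP[t0 td] <-.
      by exists t.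
    apply/eq_finite_set/inj_card_eq => x y.
    rewrite !inE/= !in_itv/= => /andP[x0 xd] /andP[y0 yd] fxy.
    have [xy|yx|//] := ltgtP x y.
      by have := fI _ _ x0 xy yd; rewrite fxy ltxx.
    by have := fI _ _ y0 yx xd; rewrite fxy ltxx.
  move=> /countable_lebesgue_measure0; rewrite lebesgue_measure_itv/= lte_fin d0.
  by rewrite oppr0 adde0 => /eqP; rewrite eqe gt_eqF.
have fJ s s' : 0 < s -> s < d -> 0 < s' -> s' < d -> f s < f s' -> s < s'.
  move=> s0 sd s0' sd' fss'; have [//|s's|ss'] := ltgtP s s'.
    by have := lt_trans fss' (fI _ _ s0' s's sd); rewrite ltxx.
  by rewrite ss' ltxx in fss'.
have [t [t0 [td ft]]] := abQ ((a + b) / 2) ltac:(lra) ltac:(lra).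
exists t; split=> //; apply/continuous_atP => e e0.
pose m := Num.min (e / 2) ((b - a) / 4).
have m0 : 0 < m by rewrite lt_min !divr_gt0// subr_gt0.
have me : m < e by rewrite gt_min (_ : e / 2 < e)//; lra.
have mb : m <= (b - a) / 4 by rewrite ge_min lexx orbT.
have [t1 [t10 [t1d ft1]]] := abQ ((a + b) / 2 - m) ltac:(lra) ltac:(lra).
have [t2 [t20 [t2d ft2]]] := abQ ((a + b) / 2 + m) ltac:(lra) ltac:(lra).
have t1t : t1 < t by apply: fJ => //; rewrite -ft1 -ft; lra.
have tt2 : t < t2 by apply: fJ => //; rewrite -ft2 -ft; lra.
exists (Num.min (t - t1) (t2 - t)); split; first by rewrite lt_min !subr_gt0 t1t.
move=> s; rewrite lt_min => /andP[]; rewrite !ltr_norml => /andP[s1 _] /andP[_ s2].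
have l1 : f t1 < f s by apply: fI => //; lra.
have l2 : f s < f t2 by apply: fI => //; lra.
by apply/andP; split; lra.
Qed.

(** By the dichotomy, one continuity point in each interval [(0, m)] suffices. *)
Lemma germ_continuous f : def_fun S f ->
  \forall t \near 0^'+, {for t, continuous f}.
Proof.
move=> df; pose Q t := forall e, 0 < e -> exists d, 0 < d /\
  forall s, `|s - t| < d -> `|f t - f s| < e.
suff : \forall t \near 0^'+, Q t by apply: filterS => t; rewrite continuous_atP.
apply: (def_set_freq (S := S)); first by rewrite /Q; definability.
move=> /near0P[e e0 eP].
have [d d0 dP] := germ_monotone df.
pose m := Num.min d e; have m0 : 0 < m by rewrite lt_min d0.
have md : m <= d by rewrite ge_min lexx.
have me : m <= e by rewrite ge_min lexx orbT.
suff [t [t0 tm ct]] : exists t, [/\ 0 < t, t < m & {for t, continuous f}].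
  by apply: (eP t) => //; [exact: lt_le_trans me|apply/continuous_atP].
case: dP => H.
- apply: incr_continuity_point df m0 _ => x y x0 xy ym.
  by apply: H => //; apply: lt_le_trans md.
- have [|t [t0 tm ct]] := incr_continuity_point (def_fun_opp df) m0.
    by move=> x y x0 xy ym; rewrite ltrN2; apply: H => //; apply: lt_le_trans md.
  exists t; split=> //; apply/continuous_atP => k k0.
  have [r [r0 rP]] := (continuous_atP _ _).1 ct k k0.
  by exists r; split=> // s /rP; rewrite -opprD normrN.
- exists (m / 2); split; [lra|lra|].
  apply/continuous_atP => k k0; exists (m / 2); split; first lra.
  move=> s; rewrite ltr_norml => /andP[s1 s2].
  suff -> : f (m / 2) = f s by rewrite subrr normr0.
  have [sm|sm|->//] := ltgtP s (m / 2).
    by apply: esym; apply: H; lra.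
  by apply: H; lra.
Qed.

(** The numbers that are eventually lower bounds of [u] form an initial
segment, whose supremum is the limit by the dichotomy. *)
Lemma germ_limit u : def_fun S u ->
  [\/ exists L : R, u h @[h --> 0^'+] --> L,
      forall M, \forall h \near 0^'+, M <= u h |
      forall M, \forall h \near 0^'+, u h <= M].
Proof.
move=> du; pose C := [set c | \forall h \near 0^'+, c <= u h].
have dC c : C c \/ \forall h \near 0^'+, u h <= c.
  have [|H] := def_set_dicho (S := S) (Q := fun h => c <= u h) ltac:(definability).
    by left.
  by right; apply: filterS H => h /negP; rewrite -ltNge => /ltW.
have [C0|/set0P C0] := eqVneq C set0.
  by apply: Or33 => M; case: (dC M) => //; rewrite C0.
have [Cb|nCb] := pselect (has_ubound C); last first.
  apply: Or32 => M; apply: contrapT => nM; apply: nCb; exists M => c Cc.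
  rewrite leNgt; apply/negP => Mc; apply: nM; apply: filterS Cc => h; apply: le_trans.
  exact: ltW.
apply: Or31; exists (sup C); apply/cvgrPdist_le => e e0.
have [c Cc cL] := sup_adherent e0 (conj C0 Cb).
have [/(ub_le_sup Cb)|H] := dC (sup C + e); first by rewrite gerDl leNgt e0.
apply: filterS2 Cc H => h ch hL; rewrite ler_norml; apply/andP; split; lra.
Qed.

Definition right_derivative f t l :=
  forall e, 0 < e -> \forall h \near 0^'+, `|f (t + h) - f t - l * h| <= e * h.

Definition Dright f t := xget 0 [set l | right_derivative f t l].

Lemma right_derivative_unique f t l l' :
  right_derivative f t l -> right_derivative f t l' -> l = l'.
Proof.
move=> fl fl'; apply: contrapT => /eqP ll'.
have e0 : 0 < `|l - l'| / 3 by rewrite divr_gt0// normr_gt0 subr_eq0.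
have [h [h0 _ [H1 H2]]] : exists h, [/\ 0 < h, h < 1 &
   `|f (t + h) - f t - l * h| <= `|l - l'| / 3 * h /\
   `|f (t + h) - f t - l' * h| <= `|l - l'| / 3 * h].
  apply: near0_ex => //; apply: filterS2 (fl _ e0) (fl' _ e0) => h; by split.
have : `|l - l'| * h <= `|l - l'| / 3 * h + `|l - l'| / 3 * h.
  rewrite -{1}(gtr0_norm h0) -normrM.
  rewrite (_ : (l - l') * h = (f (t + h) - f t - l' * h) - (f (t + h) - f t - l * h)); last ring.
  by apply: le_trans (ler_normB _ _) _; rewrite lerD.
rewrite -mulrDl ler_pM2r// => H; lra.
Qed.

Lemma right_derivativeP f t l : right_derivative f t l -> Dright f t = l.
Proof.
move=> fl; rewrite /Dright; case: xgetP => [y _ fy|/(_ _ fl)//].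
exact: right_derivative_unique fy fl.
Qed.

Lemma def_Dright f : def_fun S f -> def_fun S (Dright f).
Proof.
move=> df; apply: (def_xget (P := fun r l => right_derivative f (r 0) l)).
  by move=> r y z; exact: right_derivative_unique.
by rewrite /right_derivative; definability.
Qed.

Lemma chord_ge f a b M : (forall t, a < t -> t <= b -> {for t, continuous f}) ->
  (forall t, a <= t -> t < b -> \forall h \near 0^'+, M * h <= f (t + h) - f t) ->
  a <= b -> M * (b - a) <= f b - f a.
Proof.
move=> cf fM ab.
suff H : f a - M * a <= f b - M * b by lra.
apply: (@mean_value_right R (fun t => f t - M * t) a b) => // t ta tb.
  apply: continuousB; first exact: cf.
  by apply: continuousM; [exact: cvg_cst|exact: cvg_id].
by apply: filterS (fM t ta tb) => h H; lra.
Qed.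

Lemma chord_le f a b M : (forall t, a < t -> t <= b -> {for t, continuous f}) ->
  (forall t, a <= t -> t < b -> \forall h \near 0^'+, f (t + h) - f t <= M * h) ->
  a <= b -> f b - f a <= M * (b - a).
Proof.
move=> cf fM ab.
suff H : - M * (b - a) <= - f b - - f a by lra.
apply: (@chord_ge (fun x => - f x) a b (- M) _ _ ab) => t ta tb.
  by apply: continuousN; exact: cf.
by apply: filterS (fM t ta tb) => h H; lra.
Qed.

(** At every point the difference quotient has a limit in the extended line. An
infinite right derivative at every point of an interval contradicts the mean
value inequality, whose slope would be arbitrary. *)
Lemma germ_right_derivative f : def_fun S f ->
  \forall t \near 0^'+, right_derivative f t (Dright f t).
Proof.
move=> df; have cf := germ_continuous df.
pose P1 t := exists l, right_derivative f t l.
pose P2 t := forall M, \forall h \near 0^'+, M * h <= f (t + h) - f t.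
pose P3 t := forall M, \forall h \near 0^'+, f (t + h) - f t <= M * h.
have dP1 : def_set S P1 by rewrite /P1 /right_derivative; definability.
have dP2 : def_set S P2 by rewrite /P2; definability.
have tri t : P1 t \/ (P2 t \/ P3 t).
  have du : def_fun S (fun h => (f (t + h) - f t) / h) by rewrite /def_fun; definability.
  case: (germ_limit du) => [[L /cvgrPdist_le HL]|HL|HL].
  - left; exists L => e e0.
    near=> h; have h0 : 0 < h by near: h; exact: nbhs_right_gt.
    have -> : f (t + h) - f t - L * h = - ((L - (f (t + h) - f t) / h) * h).
      by rewrite mulrBl divfK ?gt_eqF//; ring.
    rewrite normrN normrM (gtr0_norm h0) ler_pM2r//; near: h; exact: HL.
  - right; left => M; near=> h; have h0 : 0 < h by near: h; exact: nbhs_right_gt.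
    by rewrite -ler_pdivlMr//; near: h; exact: HL.
  - right; right => M; near=> h; have h0 : 0 < h by near: h; exact: nbhs_right_gt.
    by rewrite -ler_pdivrMr//; near: h; exact: HL.
have both (p q : R -> Prop) : (\forall t \near 0^'+, p t) -> (\forall t \near 0^'+, q t) ->
  exists2 d, 0 < d & forall t, 0 < t -> t < d -> p t /\ q t.
  move=> p0 q0; apply/near0P; exact: filterS2 p0 q0.
have [H1|H] := def_set_or dP1 (nearW _ tri).
  by apply: filterS H1 => t [l fl]; rewrite (right_derivativeP fl).
exfalso.
have [H2|H3] := def_set_or dP2 H.
  have [d d0 dP] := both _ _ cf H2.
  (* A slope exceeding that of the chord over [d/4, d/2]. *)
  pose M := (f (d / 2) - f (d / 4)) / (d / 4) + 1.
  have := @chord_ge f (d / 4) (d / 2) M.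
  have d4 : d / 4 != 0 by rewrite gt_eqF// divr_gt0.
  rewrite (_ : M * (d / 2 - d / 4) = f (d / 2) - f (d / 4) + d / 4); last first.
    rewrite (_ : d / 2 - d / 4 = d / 4); last lra.
    by rewrite /M mulrDl divfK// mul1r.
  have K1 t : d / 4 < t -> t <= d / 2 -> {for t, continuous f}.
    by move=> t1 t2; apply: (dP t _ _).1; lra.
  have K2 t : d / 4 <= t -> t < d / 2 -> P2 t.
    by move=> t1 t2; apply: (dP t _ _).2; lra.
  move=> /(_ K1 (fun t t1 t2 => K2 t t1 t2 M)) K.
  have : d / 4 <= d / 2 by lra.
  by move=> /K; lra.
have [d d0 dP] := both _ _ cf H3.
pose M := (f (d / 2) - f (d / 4)) / (d / 4) - 1.
have := @chord_le f (d / 4) (d / 2) M.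
have d4 : d / 4 != 0 by rewrite gt_eqF// divr_gt0.
rewrite (_ : M * (d / 2 - d / 4) = f (d / 2) - f (d / 4) - d / 4); last first.
  rewrite (_ : d / 2 - d / 4 = d / 4); last lra.
  by rewrite /M mulrBl divfK// mul1r.
have K1 t : d / 4 < t -> t <= d / 2 -> {for t, continuous f}.
  by move=> t1 t2; apply: (dP t _ _).1; lra.
have K2 t : d / 4 <= t -> t < d / 2 -> P3 t.
  by move=> t1 t2; apply: (dP t _ _).2; lra.
move=> /(_ K1 (fun t t1 t2 => K2 t t1 t2 M)) K.
have : d / 4 <= d / 2 by lra.
by move=> /K; lra.
Unshelve. all: by end_near. Qed.

Lemma is_derive_eps f x l :
  (forall e, 0 < e -> \forall s \near x, `|f s - f x - l * (s - x)| <= e * `|s - x|) ->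
  is_derive x (1 : R) f l.
Proof.
move=> H; have cvg : h^-1 *: (f (h *: (1 : R) + x) - f x) @[h --> (0 : R)^'] --> l.
  apply/cvgrPdist_le => e e0; have [d /= d0 dP] := H e e0.
  exists d => //= h; rewrite /= sub0r normrN => hd h0.
  have := dP (h *: (1 : R) + x); rewrite /= [h *: 1]mulr1 opprD addrCA subrr addr0 normrN.
  move=> /(_ hd); rewrite addrK => fh.
  have -> : l - h^-1 *: (f (h + x) - f x) = - (h^-1 * (f (h + x) - f x - l * h)).
    by rewrite [_ *: _]/(_ * _) mulrBr (mulrC l) mulKf// opprB.
  by rewrite normrN normrM normfV mulrC ler_pdivrMr ?normr_gt0.
by split; [apply: cvgP cvg|exact: cvg_lim cvg].
Qed.

(** The right derivative is a definable function, so it is continuous near 0;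
a continuous function with continuous right derivative is differentiable, because
its slopes near a point are squeezed by the mean value inequality. *)
Lemma germ_derivable f : def_fun S f ->
  \forall t \near 0^'+, is_derive t (1 : R) f (Dright f t).
Proof.
move=> df; have cf := germ_continuous df; have rf := germ_right_derivative df.
have cD := germ_continuous (def_Dright df).
have /near0P[d d0 dP] : \forall t \near 0^'+,
    [/\ {for t, continuous f}, right_derivative f t (Dright f t) & {for t, continuous (Dright f)}].
  by apply: filterS3 cf rf cD => t; split.
apply/near0P; exists d => // x x0 xd; apply: is_derive_eps => e e0.
have [_ _ cDx0] := dP x x0 xd; have cDx := (continuous_atP _ _).1 cDx0.
have e2 : 0 < e / 2 by lra.
have [r [r0 rP]] := cDx _ e2.
pose m := Num.min r (Num.min x (d - x)).
have m0 : 0 < m by rewrite !lt_min r0 x0/= subr_gt0.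
have mr : m <= r by rewrite ge_min lexx.
have mx : m <= x by rewrite !ge_min lexx orbT.
have md : m <= d - x by rewrite !ge_min lexx !orbT.
clearbody m.
have bounds a b : x - m < a -> a <= b -> b < x + m ->
    (Dright f x - e) * (b - a) <= f b - f a /\ f b - f a <= (Dright f x + e) * (b - a).
  move=> xa ab bx.
  have cab t : a < t -> t <= b -> {for t, continuous f}.
    by move=> ta tb; have [] := dP t ltac:(lra_from xa ta mx) ltac:(lra_from bx tb md).
  have dab t : a <= t -> t < b -> \forall h \near 0^'+,
      (Dright f x - e) * h <= f (t + h) - f t /\ f (t + h) - f t <= (Dright f x + e) * h.
    move=> ta tb; have [_ /(_ _ e2) rt _] := dP t ltac:(lra_from xa ta mx) ltac:(lra_from bx tb ab md).
    have := rP t; rewrite ltr_norml => /(_ ltac:(apply/andP; split; lra_from xa ta bx tb mr)); rewrite ltr_norml => /andP[D1 D2].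
    near=> h; have h0 : 0 < h by near: h; exact: nbhs_right_gt.
    have : `|f (t + h) - f t - Dright f t * h| <= e / 2 * h by near: h; exact: rt.
    have p1 : (Dright f x - Dright f t) * h <= e / 2 * h by rewrite ler_pM2r// ltW.
    have p2 : - (e / 2) * h <= (Dright f x - Dright f t) * h by rewrite ler_pM2r// ltW.
    by rewrite ler_norml => /andP[q1 q2]; split; lra_from p1 p2 q1 q2.
  split; [apply: chord_ge|apply: chord_le] => // t ta tb.
    by apply: filterS (dab t ta tb) => h [].
  by apply: filterS (dab t ta tb) => h [].
exists m => //= s; rewrite /= => sm.
move: sm; rewrite ltr_norml => /andP[s1 s2].
have [sx|xs] := leP s x.
  have [] := bounds s x ltac:(lra_from s2) sx ltac:(lra_from m0).
  rewrite [`|s - x|]ler0_norm ?ler_norml; last lra.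
  by move=> H1 H2; apply/andP; split; lra_from H1 H2.
have [] := bounds x s ltac:(lra_from m0) (ltW xs) ltac:(lra_from s1).
rewrite [`|s - x|]ger0_norm ?ler_norml; last lra.
by move=> H1 H2; apply/andP; split; lra_from H1 H2.
Unshelve. all: by end_near. Qed.

End Regularity.

(** * Decay and power asymptotics *)

Section DerivativeSigns.
Variable R : realType.
Implicit Types (F dF : R -> R).

Lemma is_derive_scale (k x : R) F (dF : R) : is_derive x (1 : R) F dF ->
  is_derive x (1 : R) (fun t => k * F t) (k * dF).
Proof. by move=> dFx; have := is_deriveZ k dFx. Qed.

Lemma derivative_ge0_nondecreasing F dF a b :
  (forall t : R, a < t -> t < b -> is_derive t (1 : R) F (dF t) /\ 0 <= dF t) ->
  forall x y, a < x -> x <= y -> y < b -> F x <= F y.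
Proof.
move=> H x y ax; rewrite le_eqVlt => /predU1P[->//|xy yb].
have [||c] := @MVT R F dF x y xy.
- by move=> t; rewrite in_itv/= => /andP[xt ty]; apply: (H t _ _).1; lra.
- apply: derivable_within_continuous => t; rewrite in_itv/= => /andP[xt ty].
  by have [[]] := H t ltac:(lra) ltac:(lra).
rewrite in_itv/= => /andP[xc cy] Fxy.
have [_ dFc] := H c ltac:(lra) ltac:(lra).
by rewrite -subr_ge0 Fxy mulr_ge0// subr_ge0 ltW.
Qed.

Lemma germ_derivative_ge0 F dF : F t @[t --> 0^'+] --> (0 : R) ->
  (\forall t \near 0^'+, is_derive t (1 : R) F (dF t)) ->
  (\forall t \near 0^'+, 0 <= dF t) -> \forall t \near 0^'+, 0 <= F t.
Proof.
move=> F0 F1 F2.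
have /near0P[d d0 dP] : \forall t \near 0^'+, is_derive t (1 : R) F (dF t) /\ 0 <= dF t.
  exact: filterS2 F1 F2.
apply/near0P; exists d => // t t0 td; rewrite leNgt; apply/negP => Ft.
have [s [s0 st]] := near0_ex t0 (cvgr_gt _ F0 _ Ft).
rewrite ltNge => /negP; apply.
by apply: (@derivative_ge0_nondecreasing F dF 0 d) => //; exact: ltW.
Qed.

(** Two integrations of [2 M <= F'']; the constants of integration vanish. *)
Lemma germ_derivative_ge_quadratic F dF ddF M :
  F t @[t --> 0^'+] --> (0 : R) -> dF t @[t --> 0^'+] --> (0 : R) ->
  (\forall t \near 0^'+, is_derive t (1 : R) F (dF t)) ->
  (\forall t \near 0^'+, is_derive t (1 : R) dF (ddF t)) ->
  (\forall t \near 0^'+, 2 * M <= ddF t) -> \forall t \near 0^'+, M * t ^+ 2 <= F t.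
Proof.
move=> F0 dF0 dFP ddFP ddFM.
have idc : (fun t : R => t) t @[t --> 0^'+] --> (0 : R).
  by apply: cvg_at_right_filter; exact: cvg_id.
have L1 : \forall t \near 0^'+, 0 <= dF t - 2 * M * t.
  apply: (@germ_derivative_ge0 (fun t => dF t - 2 * M * t) (fun t => ddF t - 2 * M * 1)).
  - rewrite -[X in _ --> X](_ : 0 - 2 * M * 0 = 0); last by rewrite mulr0 subr0.
    by apply: cvgB => //; apply: cvgM => //; exact: cvg_cst.
  - apply: filterS ddFP => t dt; apply: is_deriveB.
  - by apply: filterS ddFM => t; rewrite mulr1 subr_ge0.
suff : \forall t \near 0^'+, 0 <= F t - M * t ^+ 2.
  by apply: filterS => t; rewrite subr_ge0.
apply: (@germ_derivative_ge0 _ (fun t => dF t - 2 * M * t)) => //.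
  rewrite -[X in _ --> X](_ : 0 - M * 0 = 0); last by rewrite mulr0 subr0.
  apply: cvgB => //; apply: cvgM; first exact: cvg_cst.
  rewrite -[X in _ --> X](_ : 0 * 0 = 0); last by rewrite mulr0.
  by under eq_fun do rewrite expr2; apply: cvgM.
apply: filterS dFP => t dt; apply: is_deriveB.
have -> : 2 * M * t = M * (2 * t) by rewrite mulrCA mulrA.
apply: is_derive_scale; apply: is_derive_eq.
by rewrite [t%:A]mulr1 mulr_natl mulr2n.
Qed.

End DerivativeSigns.

Section Decay.
Variables (R : realType) (S : ominimal_structure R).
Hypothesis S_poly : polynomially_bounded S.
Implicit Types (f w : R -> R).

Lemma def_rel_definable (Q : R -> R -> Prop) : def_rel S Q ->
  definable S [set z : 'rV[R]_2 | Q (z 0 0) (z 0 1)].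
Proof.
case=> n /(defn_le (leq_addl 2 n)) /defn_projn[A dA QA].
suff -> : [set z : 'rV[R]_2 | Q (z 0 0) (z 0 1)] = A by [].
apply/funext => z; apply/propext.
pose r i : R := if i is 0%N then z 0 0 else z 0 1.
have <- : coords 2 r = z.
  by apply/rowP => -[[|[|//]] ?]; rewrite !mxE /=; congr (z 0 _); apply/val_inj.
rewrite -QA /=; split=> [Qx|[r' [r0]]].
  by exists r; split=> //; move: Qx; rewrite !mxE.
by rewrite !r0// !mxE.
Qed.

Lemma definable_def_rel (X : set 'rV[R]_2) : definable S X ->
  def_rel S (fun a b => X (\row_i if i == 0 then a else b)).
Proof.
move=> dX; exists 2; exists X => // r.
suff -> : coords 2 r = \row_i (if i == 0 then r 0 else r 1) by [].
apply/rowP => -[[|[|//]] ?]; by rewrite !mxE.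
Qed.

(** [m] is the infimum of the [t > 0] with [y <= |w t|], the first instant at which
[|w|] reaches the level [y]. It replaces an inverse function of [|w|]. *)
Definition sublevel_inf w y m :=
  (forall t, 0 < t -> y <= `|w t| -> m <= t) /\
  (forall m', (forall t, 0 < t -> y <= `|w t| -> m' <= t) -> m' <= m).

(** A Lojasiewicz inequality. Let [v y] be the first instant at which [|w|] reaches
[y]. It is positive since [w] tends to 0, and [s |-> 1 / v (1 / s)] is
definable, so [1 / v (1 / s) <= s ^+ N] for large [s], that is, [y ^+ N <= v y]
for small [y > 0]. Taking [y = |w t|] gives the claim, since [v |w t| <= t]. *)
Lemma germ_polynomial_decay w : def_fun S w -> w t @[t --> 0^'+] --> (0 : R) ->
  exists2 N, (0 < N)%N & \forall t \near 0^'+, `|w t| ^+ N <= t.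
Proof.
move=> dw w0; pose v y := xget 0 [set m | sublevel_inf w y m].
have inf_unique y m m' : sublevel_inf w y m -> sublevel_inf w y m' -> m = m'.
  by move=> [H1 H2] [H3 H4]; apply/le_anti/andP; split; [exact: H4|exact: H2].
have dv : def_fun S v.
  apply: (def_xget (P := fun r m => sublevel_inf w (r 0) m)).
    by move=> r y z; exact: inf_unique.
  by rewrite /sublevel_inf; definability.
have dk : def_fun S (fun s => (v s^-1)^-1) by rewrite /def_fun; definability.
have vP t : 0 < t -> 0 < `|w t| -> 0 < v `|w t| <= t.
  move=> t0 wt0.
  pose A := [set s | 0 < s /\ `|w t| <= `|w s|].
  have At : A t by [].
  have lbA : lbound A 0 by move=> s [/ltW].
  have infP : sublevel_inf w `|w t| (inf A).
    split=> [s s0 ws|m' H]; first by apply: ge_inf; [exists 0|].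
    by apply: lb_le_inf; [exists t|move=> s [s0 ws]; exact: H].
  have -> : v `|w t| = inf A.
    by rewrite /v; case: xgetP => [m _ Hm|/(_ _ infP)//]; exact: inf_unique Hm infP.
  apply/andP; split; last by case: infP => + _; apply.
  have /near0P[d d0 dP] : \forall s \near 0^'+, `|w s| < `|w t|.
    have /cvgrPdist_lt/(_ _ wt0) := w0.
    by apply: filterS => s; rewrite sub0r normrN.
  apply: (lt_le_trans d0); case: infP => _; apply => s s0 ws.
  by rewrite leNgt; apply/negP => sd; have := dP s s0 sd; rewrite ltNge ws.
have dgraph : definable S (graph_on setT (fun s => (v s^-1)^-1)).
  have := @def_rel_definable (fun s y => y = (v s^-1)^-1).
  have -> : [set z : 'rV[R]_2 | z 0 1 = (v (z 0 0)^-1)^-1] = graph_on setT (fun s => (v s^-1)^-1).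
    by apply/funext => z; apply/propext; split=> [|[]].
  by apply; apply: (def_rename (fun i => if i is 0 then 1 else 0)%N dk).
have [N [M [_ MP]]] := S_poly dgraph.
exists N.+1 => //.
pose m := Num.min 1 (`|M| + 1)^-1.
have M1 : 0 < `|M| + 1 by rewrite ltr_wpDl.
have m0 : 0 < m by rewrite lt_min ltr01 invr_gt0.
near=> t.
have t0 : 0 < t by near: t; exact: nbhs_right_gt.
have wtm : `|w t| < m.
  near: t; have /cvgrPdist_lt/(_ _ m0) := w0.
  by apply: filterS => s; rewrite sub0r normrN.
have wt1 : `|w t| < 1 by apply: lt_le_trans wtm _; rewrite ge_min lexx.
have [->|wtn0] := eqVneq (w t) 0; first by rewrite normr0 expr0n ltW.
have wt0 : 0 < `|w t| by rewrite normr_gt0.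
have /andP[vt0 vt] := vP t t0 wt0.
have := MP `|w t|^-1; rewrite invrK.
have -> : M < `|w t|^-1.
  have : `|w t| < (`|M| + 1)^-1 by apply: lt_le_trans wtm _; rewrite ge_min lexx orbT.
  rewrite invf_pgt ?posrE// => /(lt_trans _); apply.
  by rewrite (le_lt_trans (ler_norm _))// ltrDl.
move=> /(_ isT); rewrite gtr0_norm ?invr_gt0// exprVn lef_pV2 ?posrE ?exprn_gt0//.
move=> wv; apply: le_trans vt; apply: le_trans wv.
by rewrite exprS ler_piMl ?exprn_ge0// ltW.
Unshelve. all: by end_near. Qed.

(** The logarithmic derivative [u t = t f'(t) / f(t)] has a limit; it is finite
because [t ^+ 2 <= f t <= t]. Let [L] be the limit, so [(ln f - L ln t)' = (u - L) / t].
By polynomial decay this is [O(t ^ (1/N - 1))], which is integrable at 0, so [ln f - L ln t]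
converges and [f / t ^ L] has a positive limit. *)
Lemma germ_power_asymptotics f : def_fun S f ->
  (\forall t \near 0^'+, t ^+ 2 <= f t) -> (\forall t \near 0^'+, f t <= t) ->
  exists a al : R, 0 < a /\ f t / t `^ al @[t --> 0^'+] --> a.
Proof.
move=> df flb fub.
have fP := germ_derivable df.
pose u t := t * Dright f t / f t.
have dDf := def_Dright df.
have du : def_fun S u by rewrite /def_fun /u; definability.
pose G c t := ln (f t) - c * ln t.
have GP c : \forall t \near 0^'+, [/\ 0 < t, 0 < f t, t ^+ 2 <= f t, f t <= t &
    is_derive t (1 : R) (G c) ((u t - c) / t)].
  near=> t; have t0 : 0 < t by near: t; exact: nbhs_right_gt.
  have flbt : t ^+ 2 <= f t by near: t.
  have ft0 : 0 < f t by apply: lt_le_trans flbt; rewrite exprn_gt0.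
  split=> //; first by near: t.
  have ft : is_derive t (1 : R) f (Dright f t) by near: t.
  have -> : (u t - c) / t = (f t)^-1 * Dright f t - c * t^-1.
    rewrite /u mulrBl; congr (_ - _).
    by field; rewrite !gt_eqF.
  have lnf : is_derive t (1 : R) (fun s => ln (f s)) ((f t)^-1 * Dright f t).
    exact: is_derive1_comp (is_derive1_ln ft0) ft.
  exact: is_deriveB lnf (is_derive_scale c (is_derive1_ln t0)).
have [[L uL]|uM|uM] := germ_limit du.
- have w0 : (fun t => u t - L) t @[t --> 0^'+] --> (0 : R).
    by rewrite -[X in _ --> X](subrr L); apply: cvgB => //; exact: cvg_cst.
  have dw : def_fun S (fun t => u t - L) by rewrite /def_fun; definability.
  have [N N0 wN] := germ_polynomial_decay dw w0.
  pose de : R := N%:R^-1.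
  have de0 : 0 < de by rewrite invr_gt0 ltr0n.
  have KP s : \forall t \near 0^'+, is_derive t (1 : R) (fun t => G L t + s * (t `^ de / de))
      ((u t - L) / t + s * t `^ (de - 1)) /\ `|(u t - L) / t| <= t `^ (de - 1).
    near=> t; have [t0 _ _ _ Gt] :
        [/\ 0 < t, 0 < f t, t ^+ 2 <= f t, f t <= t &
        is_derive t (1 : R) (G L) ((u t - L) / t)] by near: t; exact: GP.
    split.
      have dp : is_derive t (1 : R) (fun t => s * (t `^ de / de)) (s * t `^ (de - 1)); last exact: is_deriveD.
      have -> : (fun t => s * (t `^ de / de)) = (fun t => s / de * t `^ de).
        by apply/funext => x; ring.
      have -> : s * t `^ (de - 1) = s / de * (de * t `^ (de - 1)).
        by rewrite mulrA divfK// gt_eqF.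
      by apply: is_derive_scale; exact: is_derive1_powR.
    rewrite normrM normfV (gtr0_norm t0) ler_pdivrMr//.
    rewrite [X in _ <= X]mulrC mulr_powRB1 ?(ltW t0)//.
    have : `|u t - L| ^+ N <= t by near: t; exact: wN.
    move=> /(ge0_ler_powR (ltW de0)); rewrite !nnegrE exprn_ge0// (ltW t0) => /(_ isT isT).
    by rewrite -powR_mulrn// -powRrM /de mulfV ?pnatr_eq0 -?lt0n// powRr1.
  (* G L + t^de/de is nondecreasing and G L - t^de/de is nonincreasing; the first
     is thus bounded below near 0 by the second, and it converges. *)
  have incK : exists2 d : R, 0 < d & forall x y : R, 0 < x -> x <= y -> y < d ->
      G L x + x `^ de / de <= G L y + y `^ de / de /\
      G L y - y `^ de / de <= G L x - x `^ de / de.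
    have [d d0 dP] : exists2 d : R, 0 < d & forall t : R, 0 < t -> t < d ->
      (is_derive t (1 : R) (fun t => G L t + 1 * (t `^ de / de))
      ((u t - L) / t + 1 * t `^ (de - 1)) /\ `|(u t - L) / t| <= t `^ (de - 1)) /\
      (is_derive t (1 : R) (fun t => G L t + (- 1) * (t `^ de / de))
      ((u t - L) / t + (- 1) * t `^ (de - 1)) /\ `|(u t - L) / t| <= t `^ (de - 1)).
      by apply/near0P; apply: filterS2 (KP 1) (KP (- 1)).
    exists d => // x y x0 xy yd; split.
      have := @derivative_ge0_nondecreasing R _ _ 0 d _ x y x0 xy yd.
      move=> /(_ (fun t => G L t + 1 * (t `^ de / de)) (fun t => (u t - L) / t + 1 * t `^ (de - 1))).
      rewrite !mul1r; apply => t t0 td; have [[? wt] _] := dP t t0 td; split=> //.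
      by move: wt; rewrite ler_norml => /andP[? ?]; lra.
    have := @derivative_ge0_nondecreasing R (fun t => - (G L t + (- 1) * (t `^ de / de)))
       (fun t => - ((u t - L) / t + (- 1) * t `^ (de - 1))) 0 d _ x y x0 xy yd.
    rewrite !mulN1r lerN2; apply => t t0 td; have [_ [? +]] := dP t t0 td.
    rewrite ler_norml => /andP[? ?]; split; last lra.
    exact: is_deriveN.
  have [d d0 dP] := incK.
  pose K t := G L t + t `^ de / de.
  have cK : cvg (K t @[t --> 0^'+]).
    apply: (@nondecreasing_at_right_is_cvgr R K 0).
      near=> x => a b; rewrite !in_itv/= => /andP[a0 ax] /andP[b0 bx] ab.
      apply: (dP a b a0 ab _).1; apply: lt_trans bx _.
      by near: x; exact: nbhs_right_lt.
    near=> x; exists (G L (d / 2) - (d / 2) `^ de / de) => _ [t /= + <-].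
    rewrite in_itv/= => /andP[t0 tx].
    have xd : x < d / 2 by near: x; apply: nbhs_right_lt; rewrite divr_gt0.
    have := (dP t (d / 2) t0 ltac:(lra) ltac:(lra)).2.
    move=> /le_trans; apply; rewrite /K.
    have : 0 <= t `^ de / de by rewrite divr_ge0 ?powR_ge0// ltW.
    lra.
  have pde0 : t `^ de / de @[t --> 0^'+] --> (0 : R).
    rewrite -[X in _ --> X](mul0r de^-1); apply: cvgM; last exact: cvg_cst.
    exact: powR_cvg0.
  have cG : G L t @[t --> 0^'+] --> lim (K t @[t --> 0^'+]) - 0.
    have -> : G L = (fun t => K t - t `^ de / de).
      by apply/funext => t; rewrite /K addrK.
    exact: cvgB.
  exists (expR (lim (K t @[t --> 0^'+]) - 0)), L; split; first exact: expR_gt0.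
  have cE : expR (G L t) @[t --> 0^'+] --> expR (lim (K t @[t --> 0^'+]) - 0).
    by apply: continuous_cvg cG; exact: continuous_expR.
  apply: cvg_trans cE; apply: near_eq_cvg.
  near=> t; have [t0 ft0 _ _ _] :
        [/\ 0 < t, 0 < f t, t ^+ 2 <= f t, f t <= t &
        is_derive t (1 : R) (G L) ((u t - L) / t)] by near: t; exact: GP.
  by rewrite /G expRD lnK ?posrE// expRN /powR gt_eqF.
  (* If 3 <= u near 0 then f / t^3 increases, so f = O(t^3), against t^2 <= f. *)
- have [d d0 dP] : exists2 d : R, 0 < d & forall t : R, 0 < t -> t < d -> [/\ 0 < t, 0 < f t, t ^+ 2 <= f t, f t <= t &
    is_derive t (1 : R) (G 3) ((u t - 3) / t)] /\ 3 <= u t.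
    by apply/near0P; apply: filterS2 (GP 3) (uM 3).
  have Gub t : 0 < t -> t <= d / 2 -> ln t >= - G 3 (d / 2).
    move=> t0 td; have := @derivative_ge0_nondecreasing R (G 3) _ 0 d _ t (d / 2) t0 td ltac:(lra).
    move=> /(_ (fun t => (u t - 3) / t)) H.
    have : G 3 t <= G 3 (d / 2).
      apply: H => s s0 sd; have [[_ _ _ _ ?] ?] := dP s s0 sd; split=> //.
      by rewrite divr_ge0 ?subr_ge0// ltW.
    have [[_ ft0 ft2 _ _] _] := dP t t0 ltac:(lra).
    have : ln (t ^+ 2) <= ln (f t) by rewrite ler_ln ?posrE// exprn_gt0.
    by rewrite lnXn// mulr2n {1}/G; lra.
  exfalso; pose t := Num.min (d / 2) (expR (- G 3 (d / 2) - 1)).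
  have t0 : 0 < t by rewrite lt_min expR_gt0 divr_gt0.
  have := Gub t t0 ltac:(by rewrite ge_min lexx).
  have : ln t <= ln (expR (- G 3 (d / 2) - 1)).
    by rewrite ler_ln ?posrE ?expR_gt0// ge_min lexx orbT.
  by rewrite expRK; lra.
  (* If u <= 0 near 0 then f does not increase, against 0 < f <= t. *)
- have [d d0 dP] : exists2 d : R, 0 < d & forall t : R, 0 < t -> t < d -> [/\ 0 < t, 0 < f t, t ^+ 2 <= f t, f t <= t &
    is_derive t (1 : R) (G 0) ((u t - 0) / t)] /\ u t <= 0.
    by apply/near0P; apply: filterS2 (GP 0) (uM 0).
  have Glb t : 0 < t -> t <= d / 2 -> ln t >= G 0 (d / 2).
    move=> t0 td; have := @derivative_ge0_nondecreasing R (fun t => - G 0 t) _ 0 d _ t (d / 2) t0 td ltac:(lra).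
    move=> /(_ (fun t => - ((u t - 0) / t))) H.
    have : - G 0 t <= - G 0 (d / 2).
      apply: H => s s0 sd; have [[_ _ _ _ ?] ?] := dP s s0 sd; split; first exact: is_deriveN.
      by rewrite -mulNr divr_ge0 ?subr0 ?oppr_ge0// ltW.
    have [[_ ft0 _ ftt _] _] := dP t t0 ltac:(lra).
    have : ln (f t) <= ln t by rewrite ler_ln ?posrE.
    by rewrite lerN2 {2}/G; lra.
  exfalso; pose t := Num.min (d / 2) (expR (G 0 (d / 2) - 1)).
  have t0 : 0 < t by rewrite lt_min expR_gt0 divr_gt0.
  have := Glb t t0 ltac:(by rewrite ge_min lexx).
  have : ln t <= ln (expR (G 0 (d / 2) - 1)).
    by rewrite ler_ln ?posrE ?expR_gt0// ge_min lexx orbT.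
  by rewrite expRK; lra.
Unshelve. all: by end_near. Qed.

End Decay.

(** * Closest points to a graph in the plane *)

Section Plane.
Variable R : realType.
Implicit Types (X Y : set 'rV[R]_2) (x y z : 'rV[R]_2) (f : R -> R).

Lemma cvg_sqr (T : Type) (F : set_system T) (FF : Filter F) (h : T -> R) (l : R) :
  h x @[x --> F] --> l -> h x ^+ 2 @[x --> F] --> l ^+ 2.
Proof. by move=> hl; rewrite expr2; under eq_fun do rewrite expr2; exact: cvgM. Qed.

Definition point (a b : R) : 'rV[R]_2 := \row_i if i == 0 then a else b.

Lemma point0E a b : point a b 0 0 = a. Proof. by rewrite mxE. Qed.
Lemma point1E a b : point a b 0 1 = b. Proof. by rewrite mxE. Qed.

(** The point with coordinates [a], [b] in the orthonormal frame [(c, s)], [(-s, c)]. *)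
Definition frame_point (c s a b : R) := point (a * c - b * s) (a * s + b * c).

Lemma row2P x y : x 0 0 = y 0 0 -> x 0 1 = y 0 1 -> x = y.
Proof.
move=> H0 H1; apply/rowP => -[[|[|//]] lt].
  by have -> : Ordinal lt = 0 by apply/val_inj.
by have -> : Ordinal lt = 1 by apply/val_inj.
Qed.

Lemma pointK x : point (x 0 0) (x 0 1) = x.
Proof. by apply: row2P; rewrite ?point0E ?point1E. Qed.

Definition sqnorm x : R := x 0 0 ^+ 2 + x 0 1 ^+ 2.

Lemma sqnorm_ge0 x : 0 <= sqnorm x.
Proof. by rewrite addr_ge0// sqr_ge0. Qed.

Lemma euclidean_normE x : euclidean_norm x = Num.sqrt (sqnorm x).
Proof.
rewrite /euclidean_norm /sqnorm big_ord_recl big_ord1.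
by congr (Num.sqrt (_ + x 0 _ ^+ 2)); apply/val_inj.
Qed.

Lemma closest_pointsP X x y : closest_points X x y <->
  X y /\ forall z, X z -> sqnorm (x - y) <= sqnorm (x - z).
Proof.
split=> [[Xy dxy]|[Xy yP]]; split=> //.
  move=> z Xz; rewrite -ler_sqrt ?sqnorm_ge0// -!euclidean_normE -dxy.
  apply: ge_inf; last by exists z.
  by exists 0 => _ [w _ <-]; rewrite sqrtr_ge0.
apply/le_anti/andP; split.
  apply: ge_inf; last by exists y.
  by exists 0 => _ [w _ <-]; rewrite sqrtr_ge0.
apply: lb_le_inf; first by exists (euclidean_norm (x - y)), y.
move=> _ [z Xz <-]; rewrite !euclidean_normE ler_sqrt ?sqnorm_ge0//; exact: yP.
Qed.

(** Matrices carry the sup norm, whose balls are boxes. *)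
Lemma near_row2P x (P : 'rV[R]_2 -> Prop) : (\forall z \near x, P z) <->
  exists2 r : R, 0 < r &
    forall z, `|z 0 0 - x 0 0| < r -> `|z 0 1 - x 0 1| < r -> P z.
Proof.
split.
  move=> /nbhs_ballP[r /= r0 rP]; exists r => // z z0 z1; apply: rP; split=> // i j.
  rewrite (ord1 i); case: j => -[|[|//]] lt; rewrite /ball/= distrC.
    by have -> : Ordinal lt = 0 by apply/val_inj.
  by have -> : Ordinal lt = 1 by apply/val_inj.
case=> r r0 rP; apply/nbhs_ballP; exists r => //= z [_ zP].
by apply: rP; rewrite distrC; exact: zP.
Qed.

Lemma near_row2_0P (P : 'rV[R]_2 -> Prop) : (\forall z \near (0 : 'rV[R]_2), P z) <->
  exists2 r : R, 0 < r & forall z, `|z 0 0| < r -> `|z 0 1| < r -> P z.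
Proof.
have row0E (j : 'I_2) : (0 : 'rV[R]_2) 0 j = 0 by rewrite mxE.
split=> [/near_row2P[r r0 rP]|[r r0 rP]]; last apply/near_row2P; exists r => // z;
  last by rewrite !row0E !subr0; exact: rP.
by move=> z0 z1; apply: rP; rewrite row0E subr0.
Qed.

Lemma sqnorm_small x (r : R) : 0 <= r -> sqnorm x < r ^+ 2 ->
  `|x 0 0| < r /\ `|x 0 1| < r.
Proof.
move=> r0 xr; have s0 := sqr_ge0 (x 0 0); have s1 := sqr_ge0 (x 0 1).
have aux (a : R) : a ^+ 2 < r ^+ 2 -> `|a| < r.
  by move=> ar; rewrite -(@ltr_pXn2r _ 2) ?nnegrE// -normrX ger0_norm ?sqr_ge0.
by rewrite /sqnorm in xr; split; apply: aux; lra.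
Qed.

(** For [s > 0] and [c >= 0], the square of the distance from [(-c, s)] to
[(t, f t)] exceeds that to the origin by [2 t (c - psi t)], where
[psi t = (2 s f(t) - t^2 - f(t)^2) / (2 t)]. The hypotheses make [psi] positive somewhere and
continuous with value 0 at 0, so it attains a positive maximum [c]. For this [c],
the origin and the point where the maximum is attained are both closest to
[(-c, s)]. Moreover [c <= s], so this point tends to 0 with [s]. *)
Lemma medial_axis_graph Y f (e : R) : 0 < e -> f 0 = 0 ->
  (\forall z \near (0 : 'rV[R]_2), Y z <-> graph_on `[0, e[ f z) ->
  (forall t, 0 < t -> t < e -> {for t, continuous f}) ->
  f t / t @[t --> 0^'+] --> (0 : R) ->
  (forall s, 0 < s -> \forall t \near 0^'+, t ^+ 2 + f t ^+ 2 < 2 * s * f t) ->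
  closure (medial_axis Y) 0.
Proof.
move=> e0 f0 /near_row2_0P[rho rho0 Yrho] cf ft0 flarge B /near_row2_0P[r r0 rB].
have {}rB a b : `|a| < r -> `|b| < r -> B (point a b).
  by move=> ar br; apply: rB; rewrite ?point0E ?point1E.
have [d1 d10 fd1] : exists2 d : R, 0 < d & forall t : R, 0 < t -> t < d -> `|f t| <= t.
  apply/near0P; near=> t; have t0 : 0 < t by near: t; exact: nbhs_right_gt.
  have : `|f t / t| < 1.
    near: t; have /cvgrPdist_lt/(_ _ ltr01) := ft0.
    by apply: filterS => t; rewrite sub0r normrN.
  by rewrite normrM normfV (gtr0_norm t0) ltr_pdivrMr// mul1r => /ltW.
pose eta := Num.min (Num.min d1 e) rho / 2.
have eta0 : 0 < eta by rewrite divr_gt0// !lt_min d10 e0.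
have [etad etae etar] : [/\ eta < d1, eta < e & eta < rho].
  have : [/\ Num.min (Num.min d1 e) rho <= d1, Num.min (Num.min d1 e) rho <= e &
             Num.min (Num.min d1 e) rho <= rho].
    by rewrite !ge_min !lexx ?orbT.
  by move: eta0; rewrite /eta => ? [? ? ?]; split; lra.
pose s := Num.min eta r / 4.
have s0 : 0 < s by rewrite divr_gt0// lt_min eta0.
have [seta sr] : 4 * s <= eta /\ 4 * s <= r.
  by rewrite /s mulrC divfK ?pnatr_eq0// !ge_min !lexx orbT.
(* The term for t = 0 is a division by 0, with value 0, which is the limit. *)
pose psi t := (2 * s * f t - t ^+ 2 - f t ^+ 2) / (2 * t).
have psi0 : psi 0 = 0 by rewrite /psi mulr0 invr0 mulr0.
have idc : (fun t : R => t) t @[t --> 0^'+] --> (0 : R).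
  by apply: cvg_at_right_filter; exact: cvg_id.
have cfx (t : R) : 0 < t -> t <= eta -> {for t, continuous psi}.
  move=> t0 te; have cft := cf t t0 (le_lt_trans te etae).
  apply: continuousM.
    apply: continuousB; first apply: continuousB.
    - by apply: continuousM => //; exact: cvg_cst.
    - exact: exprn_continuous.
    - exact: cvg_sqr.
  apply: continuousV; first by rewrite mulf_neq0// gt_eqF.
  by apply: continuousM; [exact: cvg_cst|exact: cvg_id].
have cpsi : {within `[0, eta], continuous psi}.
  apply/continuous_within_itvP => //; split.
  - by move=> t; rewrite in_itv/= => /andP[t0 te]; apply: cfx => //; exact: ltW.
  - rewrite psi0.
    pose h t := s * (f t / t) - t / 2 - f t / t * (f t / t * t) / 2.
    have hc : h t @[t --> 0^'+] --> (0 : R).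
      rewrite -[X in _ --> X](_ : s * 0 - 0 / 2 - 0 * (0 * 0) / 2 = 0); last by ring.
      apply: cvgB; first apply: cvgB.
      - by apply: cvgM => //; exact: cvg_cst.
      - by apply: cvgM => //; exact: cvg_cst.
      - apply: cvgM; last exact: cvg_cst.
        by apply: cvgM => //; apply: cvgM.
    apply: cvg_trans hc; apply: near_eq_cvg; near=> t.
    have t0 : 0 < t by near: t; exact: nbhs_right_gt.
    by rewrite /h /psi; field; rewrite gt_eqF.
  - by apply: cvg_at_left_filter; exact: cfx.
have [ts] := EVT_max (ltW eta0) cpsi; rewrite in_itv/= => /andP[ts0 tse] tsmax.
have psipos : 0 < psi ts.
  have [t [t0 te]] := near0_ex eta0 (flarge s s0) => fl.
  apply: lt_le_trans (tsmax t _); last by rewrite in_itv/= !ltW.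
  by rewrite /psi divr_gt0 ?mulr_gt0//; lra.
have {}ts0 : 0 < ts.
  by move: ts0; rewrite le_eqVlt => /predU1P[ts0|//]; move: psipos; rewrite -ts0 psi0 ltxx.
set c := psi ts.
have cE : 2 * c * ts = 2 * s * f ts - ts ^+ 2 - f ts ^+ 2.
  by rewrite /c /psi; field; rewrite gt_eqF.
have cmax (t : R) : 0 <= t -> t <= eta -> 0 <= 2 * c * t + t ^+ 2 + f t ^+ 2 - 2 * s * f t.
  rewrite le_eqVlt => /predU1P[<- _|t0 te]; first by rewrite f0 !(expr0n, mulr0, addr0, subr0).
  have := tsmax t; rewrite in_itv/= (ltW t0) te => /(_ isT).
  by rewrite -/c {1}/psi ler_pdivrMr ?mulr_gt0//; lra.
have fts : `|f ts| <= ts by apply: fd1 => //; lra_from tse etad.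
have cs : c <= s.
  move: fts; rewrite ler_norml => /andP[_ fts].
  have : 2 * c * ts <= 2 * s * ts by rewrite cE; have := sqr_ge0 ts; have := sqr_ge0 (f ts); nra.
  by rewrite ler_pM2r//; lra.
have c0 : 0 < c := psipos.
clearbody c psi s eta.
have Yts : Y (point ts (f ts)).
  apply/Yrho; rewrite ?point0E ?point1E; [by rewrite gtr0_norm//; lra_from tse etar|lra_from fts tse etar|].
  by split; rewrite ?point0E ?point1E//= in_itv/=; apply/andP; split; lra_from ts0 tse etae.
have Y0 : Y 0.
  by apply/Yrho; rewrite ?mxE ?normr0//; split; rewrite ?mxE//= in_itv/= lexx.
have sq0 : sqnorm (point (- c) s - 0) = c ^+ 2 + s ^+ 2.
  by rewrite subr0 /sqnorm point0E point1E sqrrN.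
have sqY w : Y w -> c ^+ 2 + s ^+ 2 <= sqnorm (point (- c) s - w).
  move=> Yw; rewrite leNgt; apply/negP => wlt.
  have wlt2 : sqnorm (point (- c) s - w) < (2 * s) ^+ 2.
    apply: lt_le_trans wlt _; have cc : c * c <= s * s by rewrite ler_pM// (ltW c0).
    have ss : 0 < s * s by rewrite mulr_gt0.
    by rewrite exprMn !expr2; lra_from cc ss.
  have [] := sqnorm_small _ wlt2; first by rewrite mulr_ge0 ?(ltW s0).
  rewrite !mxE /= !ltr_norml => /andP[w1 w2] /andP[w3 w4].
  have := Yw; rewrite Yrho ?ltr_norml; [|apply/andP; split; lra_from w1 w2 s0 c0 cs seta etar|apply/andP; split; lra_from w3 w4 s0 seta etar].
  move=> [/=]; rewrite in_itv/= => /andP[w00 we] w1E.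
  have := cmax _ w00 ltac:(lra_from w1 w2 s0 c0 cs seta etar).
  by move: wlt; clear -w1E; rewrite /sqnorm !mxE/= w1E; lra.
exists (point (- c) s); split; last first.
  by apply: rB; rewrite ?normrN gtr0_norm//; lra_from c0 cs s0 sr.
split.
  move=> Yc; have := Yc; rewrite Yrho ?point0E ?point1E ?normrN ?gtr0_norm//; [|lra_from c0 cs s0 seta etar|lra_from s0 seta etar].
  by move=> [/=]; rewrite in_itv/= point0E => /andP[nc _] _; lra_from nc c0.
exists 0, (point ts (f ts)); split.
- by apply/closest_pointsP; rewrite sq0; split.
- apply/closest_pointsP; split=> // z /sqY; apply: le_trans.
  by move: cE; clear; rewrite /sqnorm !mxE/=; lra.
- move=> /rowP/(_ 0); rewrite point0E mxE => ts0'; lra_from ts0 ts0'.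
Unshelve. all: by end_near. Qed.

(** When the curvature is bounded, the squared distance to a point near 0 is a
strictly convex function of the parameter, as its second derivative is close to
[2 + 2 f'^2]. Two closest points would be two minima of it. *)
Lemma no_medial_axis_graph Y f g k (e M : R) : 0 < e -> f 0 = 0 ->
  (\forall z \near (0 : 'rV[R]_2), Y z <-> graph_on `[0, e[ f z) ->
  f t @[t --> 0^'+] --> (0 : R) ->
  (\forall t \near 0^'+, is_derive t (1 : R) f (g t)) ->
  (\forall t \near 0^'+, is_derive t (1 : R) g (k t)) ->
  (\forall t \near 0^'+, `|k t| <= M) ->
  ~ closure (medial_axis Y) 0.
Proof.
move=> e0 f0 /near_row2_0P[rho rho0 Yrho] ft0 fg gk kM cl.
have M0 : 0 <= M by have [t [_ _]] := near0_ex ltr01 kM; exact: le_trans.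
pose c : R := Num.min rho (4 * (M + 1))^-1.
have c0 : 0 < c by rewrite lt_min rho0 invr_gt0 mulr_gt0// ltr_wpDl.
have crho : c <= rho by rewrite ge_min lexx.
have cM : 4 * M * c <= 1.
  have : c <= (4 * (M + 1))^-1 by rewrite ge_min lexx orbT.
  rewrite -[X in _ <= X -> _]mul1r ler_pdivlMr; [nra|].
  by rewrite mulr_gt0// ltr_wpDl.
clearbody c.
have [d d0 dP] : exists2 d : R, 0 < d & forall t : R, 0 < t -> t < d ->
    [/\ is_derive t (1 : R) f (g t), is_derive t (1 : R) g (k t), `|k t| <= M & `|f t| < c].
  apply/near0P; near=> t; split; [by near: t|by near: t|by near: t|].
  near: t; have /cvgrPdist_lt/(_ _ c0) := ft0.
  by apply: filterS => t; rewrite sub0r normrN.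
pose r := Num.min (Num.min d e) c / 4.
have r0 : 0 < r by rewrite divr_gt0// !lt_min d0 e0 c0.
have [rd re rc] : [/\ 4 * r <= d, 4 * r <= e & 4 * r <= c].
  by rewrite /r mulrC divfK ?pnatr_eq0// !ge_min !lexx ?orbT.
clearbody r.
have [x [[_ [y [z [xy xz yz]]]] xr]] : exists x : 'rV[R]_2, medial_axis Y x /\
   (`|x 0 0| < r /\ `|x 0 1| < r).
  pose B x := `|x 0 0| < r /\ `|x 0 1| < r.
  have /cl[x [Mx xr]] : \forall x \near (0 : 'rV[R]_2), B x.
    by apply/near_row2_0P; exists r.
  by exists x.
have {xr}[] := xr; rewrite !ltr_norml => /andP[x00 x01] /andP[x10 x11].
have Yt (t : R) : 0 <= t -> t < 4 * r -> Y (point t (f t)).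
  move=> t0 tr; apply/Yrho; rewrite ?point0E ?point1E.
  - by rewrite ger0_norm//; lra_from tr rc crho c0 r0.
  - have [<-|t0'] := eqVneq 0 t; first by rewrite f0 normr0.
    have [_ _ _ ftc] := dP t ltac:(by rewrite lt_neqAle t0') ltac:(lra_from tr rd); lra_from ftc crho.
  - by split; rewrite ?point0E ?point1E//= in_itv/=; apply/andP; split; lra_from t0 tr re.
have onY w : closest_points Y x w -> exists t : R, [/\ 0 <= t, t < 4 * r & w = point t (f t)].
  move=> /closest_pointsP[Yw wmin].
  have Y0 : Y 0 by rewrite (_ : 0 = point 0 (f 0)); [apply: Yt; lra_from r0|
    apply: row2P; rewrite ?point0E ?point1E ?f0 mxE].
  have wlt : sqnorm (x - w) < (3 * r) ^+ 2.
    have aux (a : R) : - r < a -> a < r -> 0 < (r - a) * (r + a).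
      by move=> a1 a2; rewrite mulr_gt0//; lra_from a1 a2.
    apply: le_lt_trans (wmin _ Y0) _; rewrite subr0 /sqnorm.
    have rr : 0 < r * r by rewrite mulr_gt0.
    by have := aux _ x00 x01; have := aux _ x10 x11; lra_from rr.
  have [] := sqnorm_small _ wlt; first lra_from r0.
  rewrite !mxE !ltr_norml => /andP[w1 w2] /andP[w3 w4].
  have := Yw; rewrite Yrho ?ltr_norml; [|apply/andP; split; lra_from w1 w2 x00 x01 rc crho|apply/andP; split; lra_from w3 w4 x10 x11 rc crho].
  move=> [/=]; rewrite in_itv/= => /andP[w00 we] w1E.
  exists (w 0 0); split=> //; first lra_from w1 w2 x00 x01 .
  by rewrite -w1E pointK.
(* D is the squared distance from x along the graph. *)
pose D t := (t - x 0 0) ^+ 2 + (f t - x 0 1) ^+ 2.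
have DE t : sqnorm (x - point t (f t)) = D t.
  by rewrite /sqnorm /D !mxE/=; ring.
(* Between two minima, D' vanishes and increases afterwards, so D is smaller there. *)
suff H (t1 t2 : R) : 0 <= t1 -> t1 < t2 -> t2 < 4 * r -> D t1 = D t2 ->
    (forall t : R, 0 <= t -> t < 4 * r -> D t2 <= D t) -> False.
  have [t1 [t10 t1r yE]] := onY _ xy; have [t2 [t20 t2r zE]] := onY _ xz.
  move/closest_pointsP: xy => [Yy ymin]; move/closest_pointsP: xz => [Yz zmin].
  have Dmin1 (t : R) : 0 <= t -> t < 4 * r -> D t1 <= D t.
    by move=> ta tb; rewrite -!DE -yE; apply: ymin; exact: Yt.
  have Dmin2 (t : R) : 0 <= t -> t < 4 * r -> D t2 <= D t.
    by move=> ta tb; rewrite -!DE -zE; apply: zmin; exact: Yt.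
  have D12 : D t1 = D t2 by apply/le_anti/andP; split; [exact: Dmin1|exact: Dmin2].
  have [t12|t21|t12] := ltgtP t1 t2.
  - exact: (H t1 t2).
  - exact: (H t2 t1).
  - by apply: yz; rewrite yE zE t12.
move=> t10 t12 t2r D12 Dmin.
have scaleE (a b : R) : a *: b = a * b by [].
pose D' t := 2 * (t - x 0 0) + 2 * (f t - x 0 1) * g t.
have DD' (t : R) : 0 < t -> t < 4 * r -> is_derive t (1 : R) D (D' t).
  move=> t0 tr; have [fgt _ _ _] := dP t t0 ltac:(lra_from tr rd).
  by apply: is_derive_eq; rewrite /D' /= !scaleE; ring.
pose D'' t := 2 + 2 * g t ^+ 2 + 2 * (f t - x 0 1) * k t.
have DD'' (t : R) : 0 < t -> t < 4 * r -> is_derive t (1 : R) D' (D'' t) /\ 0 < D'' t.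
  move=> t0 tr; have [fgt gkt kt ftc] := dP t t0 ltac:(lra_from tr rd); split.
    by apply: is_derive_eq; rewrite /D'' /= ?scaleE; ring.
  move: kt ftc; rewrite ler_norml ltr_norml => /andP[k1 k2] /andP[f1 f2].
  rewrite /D''; have := sqr_ge0 (g t).
  have : `|(f t - x 0 1) * k t| <= 2 * c * M.
    rewrite normrM; apply: ler_pM => //; rewrite ler_norml; apply/andP; split; lra_from f1 f2 k1 k2 x10 x11 rc r0.
  by rewrite ler_norml => /andP[q1 _] q2; lra_from q1 q2 cM.
have cD (t : R) : 0 < t -> t < 4 * r -> {for t, continuous D}.
  by move=> t0 tr; apply/differentiable_continuous/derivable1_diffP; have [] := DD' t t0 tr.
have cD' (t : R) : 0 < t -> t < 4 * r -> {for t, continuous D'}.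
  by move=> t0 tr; apply/differentiable_continuous/derivable1_diffP; have [[]] := DD'' t t0 tr.
have [xi] : exists2 xi, xi \in `]t1, t2[%R & is_derive xi (1 : R) D 0.
  apply: Rolle; first exact: t12; last exact: D12.
    by move=> t; rewrite in_itv/= => /andP[ta tb]; have [] := DD' t ltac:(lra_from ta t10) ltac:(lra_from tb t2r).
  apply/continuous_within_itvP => //; split.
  - by move=> t; rewrite in_itv/= => /andP[ta tb]; apply: cD; lra_from ta t10 tb t2r.
  - move: t10; rewrite le_eqVlt => /predU1P[<-|t10]; last first.
      by apply: cvg_at_right_filter; apply: cD => //; lra_from t12 t2r.
    have idc : (fun t : R => t) t @[t --> 0^'+] --> (0 : R).
      by apply: cvg_at_right_filter; exact: cvg_id.
    rewrite {2}/D f0; apply: cvgD; apply: cvg_sqr; apply: cvgB => //; exact: cvg_cst.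
  - by apply: cvg_at_left_filter; apply: cD; lra_from t10 t12 t2r.
rewrite in_itv/= => /andP[t1x xt2] Dxi.
have D'xi : D' xi = 0.
  have := DD' xi ltac:(lra_from t10 t1x) ltac:(lra_from xt2 t2r) => Dx; have <- := @derive_val _ _ _ _ _ _ _ Dx.
  exact: (@derive_val _ _ _ _ _ _ _ Dxi).
have [|| c1] := @MVT R D D' xi t2 xt2.
- by move=> t; rewrite in_itv/= => /andP[ta tb]; apply: DD'; lra_from ta tb t10 t1x t2r.
- apply: derivable_within_continuous => t; rewrite in_itv/= => /andP[ta tb].
  by have [] := DD' t ltac:(lra_from ta t10 t1x) ltac:(lra_from tb t2r).
rewrite in_itv/= => /andP[xc1 c1t] E1.
have [|| c2] := @MVT R D' D'' xi c1 xc1.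
- by move=> t; rewrite in_itv/= => /andP[ta tb]; apply: (DD'' t _ _).1; lra_from ta tb c1t t10 t1x t2r.
- apply: derivable_within_continuous => t; rewrite in_itv/= => /andP[ta tb].
  by have [[]] := DD'' t ltac:(lra_from ta t10 t1x) ltac:(lra_from tb c1t t2r).
rewrite in_itv/= D'xi subr0 => /andP[xc2 c2c] E2.
have [_ D2] := DD'' c2 ltac:(lra_from xc2 t10 t1x) ltac:(lra_from c2c c1t t2r).
have : 0 < D' c1 by rewrite E2 mulr_gt0// subr_gt0.
move=> D'c1; have : 0 < D t2 - D xi by rewrite E1 mulr_gt0// subr_gt0.
have := Dmin xi ltac:(lra_from t10 t1x) ltac:(lra_from xt2 t2r)=> D1 D3; lra_from D1 D3 D12.
Unshelve. all: by end_near. Qed.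

End Plane.

(** * Selections in the fibres of a thin planar set *)

Section Selection.
Variables (R : realType) (S : ominimal_structure R).
Variable Y : R -> R -> Prop.
Hypothesis dY : def_rel S Y.

(** [m] is the largest [c <= 1] such that [P a] holds on [(0, c)]; the bound 1 keeps
it finite. *)
Definition radius_spec (P : R -> R -> Prop) a m :=
  (forall c, c <= 1 -> (forall h, 0 < h -> h < c -> P a h) -> c <= m) /\
  (forall m', (forall c, c <= 1 -> (forall h, 0 < h -> h < c -> P a h) -> c <= m') -> m <= m').

Definition radius P a := xget 0 [set m | radius_spec P a m].

Lemma radius_unique P a m m' : radius_spec P a m -> radius_spec P a m' -> m = m'.
Proof.
by move=> [H1 H2] [H3 H4]; apply/le_anti/andP; split; [exact: H2|exact: H4].
Qed.

Lemma def_radius P : def_rel S P -> def_fun S (radius P).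
Proof.
move=> dP; apply: (def_xget (P := fun r m => radius_spec P (r 0) m)).
  by move=> r y z; exact: radius_unique.
by rewrite /radius_spec; definability.
Qed.

Lemma radiusP P a : (\forall h \near 0^'+, P a h) ->
  0 < radius P a /\ forall h, 0 < h -> h < radius P a -> P a h.
Proof.
move=> /near0P[d d0 dP].
pose A := [set c : R | c <= 1 /\ forall h, 0 < h -> h < c -> P a h].
have Am : A (Num.min d 1).
  split=> [|h h0]; first by rewrite ge_min lexx orbT.
  by rewrite lt_min => /andP[hd _]; exact: dP.
have Aub : has_ubound A by exists 1 => c [].
have supA : radius_spec P a (sup A).
  split=> [c c1 cP|m' H]; first by apply: ub_le_sup.
  by apply: ge_sup; [exists (Num.min d 1)|move=> c [c1 cP]; exact: H].
have -> : radius P a = sup A.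
  by rewrite /radius; case: xgetP => [m _ Hm|/(_ _ supA)//]; exact: radius_unique Hm supA.
split.
  by apply: lt_le_trans (ub_le_sup Aub Am); rewrite lt_min d0 ltr01.
move=> h h0; rewrite -subr_gt0 => hA.
have [c [_ cP]] := sup_adherent hA (conj (ex_intro _ _ Am) Aub).
by rewrite opprB addrC subrK => hc; exact: cP.
Qed.

Hypothesis Y_closed : forall a b, ~ Y a b -> exists2 r : R, 0 < r &
  forall a' b', `|a' - a| < r -> `|b' - b| < r -> ~ Y a' b'.

(** [m] is the smallest absolute value in the fibre of [Y] over [a]. *)
Definition height_spec a m :=
  0 <= m /\ (Y a m \/ Y a (- m)) /\ forall b, Y a b -> m <= `|b|.

Definition height a := xget 0 [set m | height_spec a m].

Lemma height_unique a m m' : height_spec a m -> height_spec a m' -> m = m'.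
Proof.
move=> [m0 [Ym mP]] [m0' [Ym' mP']]; apply/le_anti/andP; split.
  by case: Ym' => /mP; rewrite ?normrN ger0_norm.
by case: Ym => /mP'; rewrite ?normrN ger0_norm.
Qed.

Lemma def_height : def_fun S height.
Proof.
apply: (def_xget (P := fun r m => height_spec (r 0) m)).
  by move=> r y z; exact: height_unique.
by rewrite /height_spec; definability.
Qed.

Lemma heightP a b : Y a b -> height_spec a (height a).
Proof.
move=> Yab; pose A := [set `|c| | c in [set c | Y a c]].
have A0 : A !=set0 by exists `|b|, b.
have Alb : has_lbound A by exists 0 => _ [c _ <-].
have infA : height_spec a (inf A).
  have i0 : 0 <= inf A by apply: lb_le_inf => // _ [c _ <-].
  split=> //; split; last by move=> c Yc; apply: ge_inf => //; exists c.
  apply: contrapT => /not_orP[/Y_closed[r1 r10 r1P] /Y_closed[r2 r20 r2P]].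
  have r0 : 0 < Num.min r1 r2 by rewrite lt_min r10.
  have [_ [c Yc <-]] := inf_adherent r0 (conj A0 Alb).
  have ic : inf A <= `|c| by apply: ge_inf => //; exists c.
  rewrite -ltrBlDl lt_min => /andP[c1 c2].
  have [c0|c0] := leP 0 c.
    apply: (r1P a c) Yc; first by rewrite subrr normr0.
    by move: c1 ic; rewrite (ger0_norm c0) => c1 ic; rewrite ger0_norm// subr_ge0.
  apply: (r2P a c) Yc; first by rewrite subrr normr0.
  move: c2 ic; rewrite (ltr0_norm c0) => c2 ic; rewrite opprK ler0_norm; lra_from c2 ic.
by rewrite /height; case: xgetP => [m _ //|/(_ _ infA)].
Qed.

(** When [Y] meets every cone around the positive axis near 0, the points of its
fibres that are closest to the axis lie in all these cones, by the dichotomy. *)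
Lemma lowest_selection : Y 0 0 ->
  (forall eps r : R, 0 < eps -> 0 < r ->
     exists a b, [/\ 0 < a, a < r, `|b| <= eps * a & Y a b]) ->
  exists f, [/\ def_fun S f, f 0 = 0, \forall a \near 0^'+, Y a (f a) &
    forall eps, 0 < eps -> \forall a \near 0^'+, `|f a| <= eps * a].
Proof.
move=> Y00 cone; have dh := def_height.
have h0 : height 0 = 0.
  by case: (heightP Y00) => h0 [_ /(_ _ Y00)]; rewrite normr0 => ?; apply/le_anti/andP.
have hcone eps : 0 < eps -> \forall a \near 0^'+, height_spec a (height a) /\ height a <= eps * a.
  move=> eps0; suff H : \forall a \near 0^'+, exists b, Y a b /\ `|b| <= eps * a.
    apply: filterS H => a [b [Yab bea]]; have ha := heightP Yab; split=> //.
    by apply: le_trans bea; case: ha => _ [_]; apply.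
  apply: (def_set_freq (S := S)); first by definability.
  move=> /near0P[d d0 dP]; have [a [b [a0 ad bea Yab]]] := cone _ _ eps0 d0.
  by apply: (dP a a0 ad); exists b.
have [H|H] : (\forall a \near 0^'+, Y a (height a)) \/ (\forall a \near 0^'+, Y a (- height a)).
  apply: (def_set_or (S := S)); first by definability.
  by apply: filterS (hcone 1 ltr01) => a [[_ []]].
- exists height; split=> // eps eps0; apply: filterS (hcone _ eps0) => a [[ha _] hea].
  by rewrite ger0_norm.
- exists (fun a => - height a); split=> //; first exact: def_fun_opp.
    by rewrite h0 oppr0.
  move=> eps eps0; apply: filterS (hcone _ eps0) => a [[ha _] hea].
  by rewrite normrN ger0_norm.
Qed.

Hypothesis Y_thin : forall a0 b0 r, 0 < r ->
  exists a b : R, [/\ `|a - a0| < r, `|b - b0| < r & ~ Y a b].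

(** A strip of definable, hence continuous, positive width along the graph of a
continuous function has interior points. *)
Lemma no_strip f rho (s : R) : (s = 1 \/ s = -1) -> def_fun S f -> def_fun S rho ->
  ~ (\forall a \near 0^'+, 0 < rho a /\ forall h, 0 < h -> h < rho a -> Y a (f a + s * h)).
Proof.
move=> s1 df dr H; have cf := germ_continuous df; have cr := germ_continuous dr.
have /near0P[d d0 dP] : \forall a \near 0^'+,
    [/\ 0 < rho a /\ forall h, 0 < h -> h < rho a -> Y a (f a + s * h),
    {for a, continuous f} & {for a, continuous rho}].
  by apply: filterS3 H cf cr => a; split.
pose a := d / 2; have a0 : 0 < a by rewrite divr_gt0.
have ad : a < d by rewrite ltr_pdivrMr// mulr_natr mulr2n ltrDl.
have [[r0 _] ca cra] := dP a a0 ad.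
have e0 : 0 < rho a / 8 by rewrite divr_gt0.
have [d1 [d10 d1P]] := (continuous_atP _ _).1 ca _ e0.
have [d2 [d20 d2P]] := (continuous_atP _ _).1 cra _ e0.
pose r := Num.min (Num.min d1 d2) (Num.min (rho a / 8) (Num.min a (d - a))).
have rr : 0 < r by rewrite !lt_min d10 d20 e0 a0 subr_gt0.
have [a' [b' [aa' bb' nY]]] := Y_thin a (f a + s * (rho a / 2)) rr.
move: aa'; rewrite !lt_min => /andP[/andP[/d1P fa /d2P ra] /andP[_ /andP[a1 a2]]].
move: bb'; rewrite !lt_min => /andP[_ /andP[bb' _]].
move: a1 a2; rewrite !ltr_norml => /andP[a1 _] /andP[_ a2].
have [[_ Hs] _ _] := dP a' ltac:(lra_from a1) ltac:(lra_from a2).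
apply: nY; rewrite (_ : b' = f a' + s * (s * (b' - f a'))); last first.
  by case: s1 => ->; ring.
move: fa ra bb'; rewrite !ltr_norml => /andP[fa1 fa2] /andP[ra1 ra2] /andP[b1 b2].
by apply: Hs; clear -r0 s1 fa1 fa2 ra1 ra2 b1 b2; case: s1 b1 b2 => -> b1 b2; lra.
Qed.

(** On each vertical side of [f a], the fibre contains or misses a neighbourhood.
It cannot contain one for all small [a], by thinness. The width of the gap is a
definable function of [a]. *)
Lemma isolated_selection f : def_fun S f ->
  exists2 g, def_fun S g & \forall a \near 0^'+, 0 < g a /\
    forall b, `|b - f a| < g a -> Y a b -> b = f a.
Proof.
move=> df.
pose strip s a h := Y a (f a + s * h).
have dstrip s : def_rel S (strip s) by rewrite /strip; definability.
pose gap a h := ~ strip 1 a h /\ ~ strip (-1) a h.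
have dgap : def_rel S gap by rewrite /gap /strip; definability.
have nostrip s : s = 1 \/ s = -1 -> ~ (\forall a \near 0^'+, \forall h \near 0^'+, strip s a h).
  move=> s1 H; apply: (no_strip s1 df (def_radius (dstrip s))).
  by apply: filterS H => a; exact: radiusP.
have tri a : (\forall h \near 0^'+, strip 1 a h) \/
   ((\forall h \near 0^'+, strip (-1) a h) \/ (\forall h \near 0^'+, gap a h)).
  have [|n1] := def_set_dicho (S := S) (Q := strip 1 a) ltac:(rewrite /strip; definability).
    by left.
  have [|n2] := def_set_dicho (S := S) (Q := strip (-1) a) ltac:(rewrite /strip; definability).
    by right; left.
  by right; right; apply: filterS2 n1 n2 => h; split.
have [/nostrip[]|] := def_set_or (S := S)
    (P := fun a => \forall h \near 0^'+, strip 1 a h)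
    ltac:(rewrite /strip; definability) (nearW _ tri); first by left.
move=> /(def_set_or (S := S) (P := fun a => \forall h \near 0^'+, strip (-1) a h)
    ltac:(rewrite /strip; definability))[/nostrip[]|H]; first by right.
exists (radius gap); first exact: def_radius.
apply: filterS H => a /radiusP[g0 gP]; split=> // b bg Yab.
apply: contrapT => /eqP bf.
have [] := gP `|b - f a| ltac:(by rewrite normr_gt0 subr_eq0) bg; rewrite /strip => n1 n2.
have [b0|b0] := leP 0 (b - f a).
  by apply: n1; rewrite ger0_norm// mul1r addrC subrK.
by apply: n2; rewrite ltr0_norm// mulN1r opprK addrC subrK.
Qed.

End Selection.

(** * Rotations, and medial axes of superquadratic graphs *)

Section Rotation.
Variable R : realType.
Implicit Types (X Y : set 'rV[R]_2) (x y z : 'rV[R]_2) (U : 'M[R]_2) (f : R -> R).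

Lemma sqnormE x : sqnorm x = (x *m x^T) 0 0.
Proof.
rewrite mxE big_ord_recl big_ord1 !mxE /sqnorm !expr2.
by congr (_ + x 0 _ * x 0 _); apply/val_inj.
Qed.

Lemma sqnorm_orthogonal U x : U *m U^T = 1%:M -> sqnorm (x *m U) = sqnorm x.
Proof. by move=> UU; rewrite !sqnormE trmx_mul mulmxA -(mulmxA x) UU mulmx1. Qed.

Lemma near_sqnormP (P : 'rV[R]_2 -> Prop) : (\forall z \near (0 : 'rV[R]_2), P z) <->
  exists2 r : R, 0 < r & forall z, sqnorm z < r ^+ 2 -> P z.
Proof.
split=> [/near_row2_0P[r r0 rP]|[r r0 rP]].
  by exists r => // z /(sqnorm_small (ltW r0))[]; exact: rP.
apply/near_row2_0P; exists (r / 2); first by rewrite divr_gt0.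
move=> z z0 z1; apply: rP; rewrite /sqnorm.
have aux (a : R) : `|a| < r / 2 -> 0 < (r / 2 - a) * (r / 2 + a).
  by rewrite ltr_norml => /andP[a1 a2]; rewrite mulr_gt0//; lra_from a1 a2.
have rr : 0 < r * r by rewrite mulr_gt0.
by have := aux _ z0; have := aux _ z1; lra_from rr.
Qed.

Lemma near_orthogonal U (P : 'rV[R]_2 -> Prop) : U *m U^T = 1%:M ->
  (\forall z \near (0 : 'rV[R]_2), P z) -> \forall x \near (0 : 'rV[R]_2), P (x *m U).
Proof.
move=> UU /near_sqnormP[r r0 rP]; apply/near_sqnormP; exists r => // z zr.
by apply: rP; rewrite sqnorm_orthogonal.
Qed.

Lemma closure0P (A : set 'rV[R]_2) : closure A 0 <->
  forall r : R, 0 < r -> exists2 z, A z & sqnorm z < r ^+ 2.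
Proof.
split=> [cA r r0|H B /near_sqnormP[r r0 rB]].
  pose B z := sqnorm z < r ^+ 2.
  have /cA[z [Az Bz]] : \forall z \near (0 : 'rV[R]_2), B z.
    by apply/near_sqnormP; exists r.
  by exists z.
by have [z Az zr] := H r r0; exists z; split=> //; exact: rB.
Qed.

Lemma medial_axis_orthogonal U X x : U *m U^T = 1%:M ->
  medial_axis X x -> medial_axis [set z | X (z *m U^T)] (x *m U).
Proof.
move=> UU; have UK y : y *m U *m U^T = y by rewrite -mulmxA UU mulmx1.
have UK' y : y *m U^T *m U = y by rewrite -mulmxA (mulmx1C UU) mulmx1.
have cp y : closest_points X x y -> closest_points [set z | X (z *m U^T)] (x *m U) (y *m U).
  move=> /closest_pointsP[Xy ymin]; apply/closest_pointsP; split; first by rewrite /= UK.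
  move=> z /= /ymin; rewrite -mulmxBl sqnorm_orthogonal// => /le_trans; apply.
  by rewrite -{2}(UK' z) -mulmxBl sqnorm_orthogonal.
move=> [nXx [y [z [xy xz yz]]]]; split; first by rewrite /= UK.
exists (y *m U), (z *m U); split; [exact: cp|exact: cp|].
by move=> yzU; apply: yz; rewrite -(UK y) yzU UK.
Qed.

Lemma closure_medial_axis_orthogonal U X : U *m U^T = 1%:M ->
  closure (medial_axis X) 0 <-> closure (medial_axis [set z | X (z *m U^T)]) 0.
Proof.
have imp (V : 'M[R]_2) (Z : set 'rV[R]_2) : V *m V^T = 1%:M -> closure (medial_axis Z) 0 ->
    closure (medial_axis [set z : 'rV[R]_2 | Z (z *m V^T)]) 0.
  move=> VV clZ; have H := (closure0P _).1 clZ.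
  apply: (closure0P _).2 => r r0; have [z Mz zr] := H r r0.
  by exists (z *m V); [exact: medial_axis_orthogonal|rewrite sqnorm_orthogonal].
move=> UU; split; first exact: imp.
have UU' : U^T *m U^T^T = 1%:M by rewrite trmxK; exact: mulmx1C.
move=> /(imp _ _ UU'); congr (closure (medial_axis _) _).
by apply/funext => z /=; rewrite trmxK -mulmxA UU mulmx1.
Qed.

Lemma graph_near_orthogonal U X f (e : R) : U *m U^T = 1%:M ->
  (\forall x \near (0 : 'rV[R]_2), X x <-> graph_on `[0, e[ f (x *m U)) ->
  \forall z \near (0 : 'rV[R]_2), [set z | X (z *m U^T)] z <-> graph_on `[0, e[ f z.
Proof.
move=> UU H; have UU' : U^T *m U^T^T = 1%:M by rewrite trmxK; exact: mulmx1C.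
apply: filterS (near_orthogonal UU' H) => z /=.
by rewrite -mulmxA (mulmx1C UU) mulmx1.
Qed.

Lemma steep_graph_medial_axis U X f (e : R) : U *m U^T = 1%:M -> 0 < e -> f 0 = 0 ->
  (\forall x \near (0 : 'rV[R]_2), X x <-> graph_on `[0, e[ f (x *m U)) ->
  (forall t, 0 < t -> t < e -> {for t, continuous f}) ->
  f t / t @[t --> 0^'+] --> (0 : R) ->
  (forall s, 0 < s -> \forall t \near 0^'+, t ^+ 2 + f t ^+ 2 < 2 * s * f t) ->
  closure (medial_axis X) 0.
Proof.
move=> UU e0 f0 XU cf ft fl; apply/(closure_medial_axis_orthogonal _ UU).
exact: medial_axis_graph e0 f0 (graph_near_orthogonal UU XU) cf ft fl.
Qed.

(** Reflection in the first axis, which exchanges the cases of positive and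
negative leading coefficient. *)
Definition reflection : 'M[R]_2 := diag_mx (\row_i if i == 0 then 1 else -1).

Lemma reflection_entries x : (x *m reflection) 0 0 = x 0 0 /\ (x *m reflection) 0 1 = - x 0 1.
Proof. by rewrite !mul_mx_diag !mxE/= mulr1 mulrN1. Qed.

Lemma reflection_orthogonal : reflection *m reflection^T = 1%:M.
Proof.
rewrite tr_diag_mx mulmx_diag -diag_const_mx; congr diag_mx.
by apply/rowP => i; rewrite !mxE; case: ifP; rewrite ?mulr1// mulrNN mulr1.
Qed.

Lemma steep_graph_medial_axisN U X f (e : R) : U *m U^T = 1%:M -> 0 < e -> f 0 = 0 ->
  (\forall x \near (0 : 'rV[R]_2), X x <-> graph_on `[0, e[ f (x *m U)) ->
  (forall t, 0 < t -> t < e -> {for t, continuous f}) ->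
  f t / t @[t --> 0^'+] --> (0 : R) ->
  (forall s, 0 < s -> \forall t \near 0^'+, t ^+ 2 + f t ^+ 2 < 2 * s * - f t) ->
  closure (medial_axis X) 0.
Proof.
move=> UU e0 f0 XU cf ft fl.
apply: (@steep_graph_medial_axis (U *m reflection) X (fun t => - f t) e _ e0).
- by rewrite trmx_mul mulmxA -(mulmxA U) reflection_orthogonal mulmx1.
- by rewrite f0 oppr0.
- apply: filterS XU => x XxU; rewrite XxU mulmxA /graph_on /=.
  have [-> ->] := reflection_entries (x *m U).
  by split=> -[H1 H2]; split=> //; [rewrite H2|apply: oppr_inj].
- by move=> t t0 te; apply: continuousN; exact: cf.
- rewrite -[X in _ --> X]oppr0; under eq_fun do rewrite mulNr; exact: cvgN.
- by move=> s s0; apply: filterS (fl s s0) => t; rewrite sqrrN.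
Qed.

Lemma within_dnbhsP (D : set R) (t l : R) (q : R -> R) :
  q s @[s --> within D (t^')] --> l <->
  forall eps : R, 0 < eps -> exists2 d : R, 0 < d &
    forall s, D s -> s != t -> `|s - t| < d -> `|l - q s| < eps.
Proof.
split=> [/cvgrPdist_lt H eps eps0|H].
  have [d /= d0 dP] := H eps eps0; exists d => // s Ds st sd; apply: dP => //=.
  by rewrite distrC.
apply/cvgrPdist_lt => eps eps0; have [d d0 dP] := H eps eps0.
by exists d => //= s /=; rewrite distrC => sd st Ds; exact: dP.
Qed.

Lemma is_derive_slope f (x l : R) : is_derive x (1 : R) f l ->
  forall eps : R, 0 < eps -> exists2 d : R, 0 < d &
    forall s, s != x -> `|s - x| < d -> `|l - (f s - f x) / (s - x)| < eps.
Proof.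
move=> fl eps eps0.
have cvg : h^-1 *: (f (h *: (1 : R) + x) - f x) @[h --> (0 : R)^'] --> l.
  have -> : l = lim (h^-1 *: (f (h *: (1 : R) + x) - f x) @[h --> (0 : R)^']).
    by rewrite -(@derive_val _ _ _ _ _ _ _ fl).
  by have [] := fl.
have /cvgrPdist_lt/(_ _ eps0)[d /= d0 dP] := cvg.
exists d => // s sx sd; have := dP (s - x); rewrite /= sub0r normrN => /(_ sd).
by rewrite subr_eq0 => /(_ sx); rewrite [(s - x) *: 1]mulr1 subrK [_ *: _]mulrC.
Qed.

(** For [alpha < 2], [t ^+ 2] is negligible with respect to [|f t|], so the graph, or its
reflection, enters each disc above the axis that is tangent to it at the origin. *)
Lemma superquadratic_medial_axis (S : ominimal_structure R) X :
  superquadratic_at0 S X -> closure (medial_axis X) 0.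
Proof.
move=> [U [e [f [[UU e0 _ XU [f0 [f' [f'c f'P] f'0]]] _ [a [al [a0 _ fal al2]]]]]]].
have cf (t : R) : 0 < t -> t < e -> {for t, continuous f}.
  move=> t0 te; have := f'P t; rewrite in_itv/= (ltW t0) te => /(_ isT).
  move=> /within_dnbhsP/(_ 1 ltr01)[d d0 dP]; apply/continuous_atP => eps eps0.
  pose K := `|f' t| + 1; have K0 : 0 < K by rewrite ltr_wpDl.
  pose m := Num.min d (Num.min (eps / K) (Num.min t (e - t))).
  exists m; split; first by rewrite !lt_min d0 divr_gt0//= t0 subr_gt0.
  move=> s; rewrite !lt_min => /andP[sd /andP[sK /andP[st se]]].
  have [->|nst] := eqVneq s t; first by rewrite subrr normr0.
  have Ds : s \in `[0, e[.
    move: st se; rewrite !ltr_norml in_itv/= => /andP[s1 _] /andP[_ s2].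
    by apply/andP; split; [lra_from s1|lra_from s2].
  have := dP s Ds nst sd => q.
  have qK : `|(f s - f t) / (s - t)| < K.
    rewrite /K -(subKr (f' t) ((f s - f t) / (s - t))).
    by apply: le_lt_trans (ler_normB _ _) _; rewrite ltrD2l.
  rewrite distrC -(divfK (_ : s - t != 0) (f s - f t)) ?subr_eq0// normrM.
  apply: le_lt_trans (_ : K * `|s - t| < _); first by rewrite ler_wpM2r// ltW.
  by rewrite mulrC -ltr_pdivlMr.
have ft0 : f t / t @[t --> 0^'+] --> (0 : R).
  have := f'P 0; rewrite in_itv/= lexx e0 => /(_ isT) /within_dnbhsP H.
  apply/cvgrPdist_lt => eps eps0; have [d d0 dP] := H eps eps0.
  near=> t; have t0 : 0 < t by near: t; exact: nbhs_right_gt.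
  have te : t < e by near: t; exact: nbhs_right_lt.
  have td : t < d by near: t; exact: nbhs_right_lt.
  have := dP t; rewrite f0 f'0 !subr0; apply; rewrite ?gtr0_norm ?gt_eqF//.
  by rewrite /= in_itv/= te ltW.
have steep (b : R) (h : R -> R) : 0 < b -> (forall t, `|h t| = `|f t|) ->
    (forall t, `|f t - a * t `^ al| = `|h t - b * t `^ al|) ->
    forall s, 0 < s -> \forall t \near 0^'+, t ^+ 2 + h t ^+ 2 < 2 * s * h t.
  move=> b0 hf hb s s0.
  have b2 : 0 < b / 2 by rewrite divr_gt0.
  have /eqoP/(_ _ b2) fo := fal.
  have sb0 : 0 < s * (b / 2) by rewrite mulr_gt0.
  have al20 : 0 < 2 - al by rewrite subr_gt0.
  near=> t; have t0 : 0 < t by near: t; exact: nbhs_right_gt.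
  have p0 : 0 < t `^ al by exact: powR_gt0.
  have ho : `|h t - b * t `^ al| <= b / 2 * t `^ al.
    rewrite -hb -[X in _ <= _ * X](gtr0_norm p0); near: t; exact: fo.
  have hlb : b / 2 * t `^ al <= h t.
    by move: ho; rewrite ler_norml => /andP[ho _]; lra_from ho.
  have h0 : 0 < h t by apply: lt_le_trans hlb; rewrite mulr_gt0.
  have hs : h t < s.
    have : `|f t / t| < s.
      by near: t; have /cvgrPdist_lt/(_ _ s0) := ft0; apply: filterS => t; rewrite sub0r normrN.
    rewrite normrM normfV (gtr0_norm t0) ltr_pdivrMr// -hf (gtr0_norm h0).
    move=> /lt_le_trans; apply; rewrite ler_piMr// ?ltW//.
  have t2 : t ^+ 2 < s * h t.
    have ps : t `^ (2 - al) < s * (b / 2).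
      near: t; have /cvgrPdist_lt/(_ _ sb0) := powR_cvg0 al20.
      by apply: filterS => t; rewrite sub0r normrN ger0_norm ?powR_ge0.
    have -> : t ^+ 2 = t `^ (2 - al) * t `^ al.
      by rewrite -powRD ?subrK ?powR_mulrn ?ltW// gt_eqF// implybT.
    apply: lt_le_trans (_ : s * (b / 2) * t `^ al <= _); first by rewrite ltr_pM2r.
    by rewrite -mulrA ler_wpM2l// ltW.
  have hh : h t * h t < s * h t by rewrite ltr_pM2r.
  by rewrite (expr2 (h t)); lra_from t2 hh.
have [apos|aneg|aE] := ltgtP 0 a.
- apply: (steep_graph_medial_axis UU e0 f0 XU cf ft0).
  exact: (steep a f).
- apply: (steep_graph_medial_axisN UU e0 f0 XU cf ft0) => s s0.
  have na0 : 0 < - a by rewrite oppr_gt0.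
  have := steep (- a) (fun t => - f t) na0 _ _ s s0.
  move=> /(_ (fun t => normrN _)) /(_ _)[t|]; first by rewrite -normrN opprB mulNr opprK addrC.
  by move=> d d0 dP; exists d => // t t1 t2; have := dP t t1 t2; rewrite sqrrN.
- by rewrite -aE eqxx in a0.
Unshelve. all: by end_near. Qed.

End Rotation.

(** * Tangent directions and rotated frames *)

Section Tangent.
Variable R : realType.
Implicit Types (X : set 'rV[R]_2) (x y z p u : 'rV[R]_2).

Lemma circle_compact : compact [set z : 'rV[R]_2 | sqnorm z = 1].
Proof.
apply: bounded_closed_compact.
  exists 2; split=> // M M2 z /= z1.
  have [z0 z1'] : `|z 0 0| < 2 /\ `|z 0 1| < 2.
    by apply: sqnorm_small => //; rewrite z1; lra.
  rewrite [`|z|]mx_normrE; apply: bigmax_le => [|[i j] _ /=]; first lra.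
  rewrite (ord1 i); case: j => -[|[|//]] lt.
    have -> : Ordinal lt = 0 by apply/val_inj.
    exact: ltW (lt_trans z0 M2).
  have -> : Ordinal lt = 1 by apply/val_inj.
  exact: ltW (lt_trans z1' M2).
have sqc : continuous (@sqnorm R).
  have c (j : 'I_2) (z : 'rV[R]_2) : (fun z' : 'rV[R]_2 => z' 0 j) @ z --> z 0 j := @coord_continuous R 1 2 0 j z.
  move=> z; exact: cvgD (cvg_sqr _ (c 0 z)) (cvg_sqr _ (c 1 z)).
have -> : [set z : 'rV[R]_2 | sqnorm z = 1] = @sqnorm R @^-1` [set 1] by [].
by apply: closed_comp; [move=> z _; exact: sqc|exact: closed_eq].
Qed.

Lemma sqnormZ (a : R) x : sqnorm (a *: x) = a ^+ 2 * sqnorm x.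
Proof. by rewrite /sqnorm !mxE; ring. Qed.

Lemma sqnorm_gt0 x : x <> 0 -> 0 < sqnorm x.
Proof.
move=> x0; rewrite lt_neqAle sqnorm_ge0 andbT eq_sym; apply/eqP => /eqP.
rewrite paddr_eq0 ?sqr_ge0// !sqrf_eq0 => /andP[/eqP x00 /eqP x01].
by apply: x0; apply: row2P; rewrite mxE.
Qed.

(** The vector [n v] in the frame of [u] has abscissa at least [n / 2] and ordinate at
most [2 n de]. *)
Lemma close_to_unit_vector (v0 v1 u0 u1 n de eps r : R) :
  0 < eps -> 4 * de <= eps -> 4 * de <= 1 -> 0 < n -> n < r ->
  `|v0 - u0| < de -> `|v1 - u1| < de -> u0 ^+ 2 + u1 ^+ 2 = 1 -> v0 ^+ 2 + v1 ^+ 2 = 1 ->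
  exists a b, [/\ 0 < a, a < r, `|b| <= eps * a &
    frame_point u0 u1 a b = point (n * v0) (n * v1)].
Proof.
move=> eps0 de1 de2 n0 nr d0 d1 uu vv.
have prod (w c : R) : c ^+ 2 <= 1 -> `|w| < de -> `|w * c| <= de.
  move=> c1 wd; have c1' : `|c| <= 1.
    by rewrite -(@ler_pXn2r _ 2) ?nnegrE// -normrX expr1n ger0_norm// sqr_ge0.
  by rewrite normrM -[X in _ <= X]mulr1 ler_pM// ltW.
have uu0 : u0 ^+ 2 <= 1 by have := sqr_ge0 u1; lra.
have uu1 : u1 ^+ 2 <= 1 by have := sqr_ge0 u0; lra.
have := prod _ _ uu0 d0; have := prod _ _ uu1 d1; have := prod _ _ uu0 d1; have := prod _ _ uu1 d0.
rewrite !ler_norml => /andP[A1 A2] /andP[A3 A4] /andP[A5 A6] /andP[A7 A8].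
pose dot := v0 * u0 + v1 * u1; pose cross := v1 * u0 - v0 * u1.
have dot1 : dot <= 1.
  by rewrite /dot; have := sqr_ge0 (v0 - u0); have := sqr_ge0 (v1 - u1); lra.
have dot2 : 1 / 2 <= dot by rewrite /dot; lra.
have cr : `|cross| <= 2 * de.
  by rewrite /cross ler_norml; apply/andP; split; lra.
exists (n * dot), (n * cross); split.
- by rewrite mulr_gt0//; lra_from dot2.
- by apply: le_lt_trans nr; rewrite ler_piMr// ltW.
- rewrite normrM (gtr0_norm n0) mulrCA ler_pM2l//; apply: le_trans cr _.
  apply: le_trans (_ : eps * (1 / 2) <= _); first lra_from de1.
  by rewrite ler_pM2l.
- rewrite /frame_point (_ : n * dot * u0 - n * cross * u1 = n * v0); last first.
    by rewrite -[RHS]mulr1 -uu /dot /cross; ring.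
  rewrite (_ : n * dot * u1 + n * cross * u0 = n * v1) //.
  by rewrite -[RHS]mulr1 -uu /dot /cross; ring.
Qed.

(** By compactness of the unit circle, the directions of the points of [X] near 0
have a cluster point [u]. *)
Lemma tangent_direction X : closure (X `\ 0) 0 -> exists u, sqnorm u = 1 /\
  forall eps r : R, 0 < eps -> 0 < r -> exists a b, [/\ 0 < a, a < r, `|b| <= eps * a &
    X (frame_point (u 0 0) (u 0 1) a b)].
Proof.
move=> cX; pose nrm p : R := Num.sqrt (sqnorm p).
pose dir p := (nrm p)^-1 *: p.
pose F := dir @ within (X `\ 0) (nbhs (0 : 'rV[R]_2)).
have PF : ProperFilter (within (X `\ 0) (nbhs (0 : 'rV[R]_2))) := within_nbhs_proper cX.
have nrm0 p : p <> 0 -> 0 < nrm p by move=> /sqnorm_gt0; rewrite sqrtr_gt0.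
have dir1 p : p <> 0 -> sqnorm (dir p) = 1.
  move=> p0; rewrite sqnormZ exprVn sqr_sqrtr ?sqnorm_ge0// mulVf// gt_eqF//.
  exact: sqnorm_gt0.
have Fcircle : F [set z | sqnorm z = 1].
  by apply: (@nearW _ (nbhs (0 : 'rV[R]_2))) => p [_ p0]; exact: dir1.
have [u [u1 uF]] := circle_compact (fmap_proper_filter dir PF) Fcircle.
exists u; split=> // eps r eps0 r0.
pose de := Num.min eps 1 / 4.
have de0 : 0 < de by rewrite divr_gt0// lt_min eps0 ltr01.
have [de1 de2] : 4 * de <= eps /\ 4 * de <= 1.
  by rewrite /de mulrC divfK ?pnatr_eq0// !ge_min !lexx orbT.
clearbody de.
pose A := [set dir p | p in [set p | (X `\ 0) p /\ sqnorm p < r ^+ 2]].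
pose B := [set z : 'rV[R]_2 | `|z 0 0 - u 0 0| < de /\ `|z 0 1 - u 0 1| < de].
have FA : F A.
  apply: (@filterS _ (nbhs (0 : 'rV[R]_2)) _ [set p | sqnorm p < r ^+ 2]).
    by move=> p pr Xp; exists p.
  by apply/near_sqnormP; exists r.
have uB : nbhs u B by apply/near_row2P; exists de.
have [_ [[p [[Xp p0] pr] <-] [d0 d1]]] := uF A B FA uB.
have n0 := nrm0 _ p0; set n := nrm p in n0.
have pE : p = n *: dir p by rewrite /dir -/n scalerA mulfV ?scale1r// gt_eqF.
have v1 := dir1 _ p0; set v := dir p in v1 pE d0 d1.
have nr : n < r.
  by rewrite -(@ltr_pXn2r _ 2) ?nnegrE ?ltW// sqr_sqrtr ?sqnorm_ge0.
have p00 : p 0 0 = n * v 0 0 by rewrite {1}pE mxE.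
have p01 : p 0 1 = n * v 0 1 by rewrite {1}pE mxE.
have [a [b [a0 ar bea E]]] :=
  close_to_unit_vector eps0 de1 de2 n0 nr d0 d1 u1 v1.
by exists a, b; split=> //; rewrite E -p00 -p01 pointK.
Qed.

End Tangent.

Section RotatedFrame.
Variables (R : realType) (S : ominimal_structure R).
Implicit Types (X : set 'rV[R]_2) (x y z p u : 'rV[R]_2) (f : R -> R)
  (a b c s k l r : R).

Definition rotation (c s : R) : 'M[R]_2 :=
  \matrix_(i, j) if i == j then c else if i == 0 then - s else s.

Lemma rotation_entries c s x :
  (x *m rotation c s) 0 0 = x 0 0 * c + x 0 1 * s /\
  (x *m rotation c s) 0 1 = x 0 1 * c - x 0 0 * s.
Proof.
have E1 : lift ord0 ord0 = 1 :> 'I_2 by apply/val_inj.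
rewrite !mxE !big_ord_recl !big_ord0 !mxE E1 /= !addr0; split=> //.
by rewrite mulrN addrC.
Qed.

Lemma rotation_orthogonal c s : c ^+ 2 + s ^+ 2 = 1 ->
  rotation c s *m (rotation c s)^T = 1%:M.
Proof.
move=> cs; have E1 : lift ord0 ord0 = 1 :> 'I_2 by apply/val_inj.
apply/matrixP => i j; rewrite !mxE !big_ord_recl big_ord0 !mxE E1 /= addr0.
case: i => -[|[|//]] li; case: j => -[|[|//]] lj; rewrite /= ?mulr1n ?mulr0n -?cs; ring.
Qed.

Lemma frame_pointK c s x : c ^+ 2 + s ^+ 2 = 1 ->
  frame_point c s ((x *m rotation c s) 0 0) ((x *m rotation c s) 0 1) = x.
Proof.
move=> cs; have [-> ->] := rotation_entries c s x.
by apply: row2P; rewrite ?point0E ?point1E -[RHS]mulr1 -cs; ring.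
Qed.

Lemma frame_point_rotation c s a b : c ^+ 2 + s ^+ 2 = 1 ->
  (frame_point c s a b *m rotation c s) 0 0 = a /\
  (frame_point c s a b *m rotation c s) 0 1 = b.
Proof.
move=> cs; have [-> ->] := rotation_entries c s (frame_point c s a b).
by rewrite point0E point1E; split; rewrite -[RHS]mulr1 -cs; ring.
Qed.

Lemma unit_component c s : c ^+ 2 + s ^+ 2 = 1 -> `|c| <= 1 /\ `|s| <= 1.
Proof.
have abs1 (k l : R) : k ^+ 2 + l ^+ 2 = 1 -> `|k| <= 1.
  move=> kl; rewrite -(@ler_pXn2r _ 2) ?nnegrE// -normrX expr1n ger0_norm ?sqr_ge0//.
  by have := sqr_ge0 l; lra_from kl.
by move=> cs; split; [exact: abs1 cs|apply: (@abs1 s c); rewrite addrC].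
Qed.

Lemma norm_combination_lt a b k l r : `|a| < r / 2 -> `|b| < r / 2 ->
  `|k| <= 1 -> `|l| <= 1 -> `|a * k + b * l| < r.
Proof.
move=> ar br k1 l1; apply: le_lt_trans (ler_normD _ _) _; rewrite !normrM.
have : `|a| * `|k| <= `|a| by rewrite ler_piMr.
have : `|b| * `|l| <= `|b| by rewrite ler_piMr.
by move=> h1 h2; lra_from ar br h1 h2.
Qed.

(** A set with interior points in the plane would have dimension 2. *)
Lemma thin_of_dimension X : has_dimension X 1 -> forall p (r : R), 0 < r ->
  exists x, [/\ `|x 0 0 - p 0 0| < r, `|x 0 1 - p 0 1| < r & ~ X x].
Proof.
move=> [_ dimX] p r r0; apply: contrapT => /forallNP H.
suff : (2 <= 1)%N by [].
apply: dimX; exists id; split=> //; exists p.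
apply/near_row2P; exists r => // x x0 x1; exists x.
  by apply: contrapT => nX; apply: (H x).
by apply/rowP => j; rewrite mxE.
Qed.

End RotatedFrame.

(** * The germ of the curve is a graph *)

Section GraphGerm.
Variables (R : realType) (S : ominimal_structure R).
Implicit Types (X : set 'rV[R]_2) (x y z p u : 'rV[R]_2) (f g : R -> R).

(** The derivative has a limit, and a limit other than 0 would give [f] a nonzero
slope at 0. *)
Lemma germ_limit_zero f D : def_fun S D -> f t @[t --> 0^'+] --> (0 : R) ->
  (forall eps : R, 0 < eps -> \forall t \near 0^'+, `|f t| <= eps * t) ->
  (\forall t \near 0^'+, is_derive t (1 : R) f (D t)) ->
  D t @[t --> 0^'+] --> (0 : R).
Proof.
move=> dD f0 ft fD.
have idc : (fun t : R => t) t @[t --> 0^'+] --> (0 : R).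
  by apply: cvg_at_right_filter; exact: cvg_id.
have no_pos (s c : R) : s ^+ 2 = 1 -> 0 < c -> ~ (\forall t \near 0^'+, c <= s * D t).
  move=> s1 c0 H.
  have : \forall t \near 0^'+, 0 <= s * f t - c * t.
    apply: (@germ_derivative_ge0 R _ (fun t => s * D t - c * 1)).
    - rewrite -[X in _ --> X](_ : s * 0 - c * 0 = 0); last by rewrite !mulr0 subr0.
      by apply: cvgB; apply: cvgM => //; exact: cvg_cst.
    - apply: filterS fD => t ftD.
      by apply: is_deriveB; apply: is_derive_scale.
    - by apply: filterS H => t; rewrite mulr1 subr_ge0.
  have c2 : 0 < c / 2 by rewrite divr_gt0.
  move=> H2; have [t [t0 _ [H3 H4]]] := near0_ex ltr01 (filterS2 _ (fun t a b => conj a b) H2 (ft _ c2)).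
  have : s * f t <= `|f t|.
    have : `|s| = 1 by apply/eqP; rewrite -(@eqrXn2 _ 2)// ?expr1n// -normrX s1 normr1.
    by move=> s1'; apply: le_trans (ler_norm _) _; rewrite normrM s1' mul1r.
  have ct : 0 < c * t by rewrite mulr_gt0.
  by lra_from H3 H4 ct.
have one1 : (1 : R) ^+ 2 = 1 by rewrite expr1n.
have mone : (- 1 : R) ^+ 2 = 1 by rewrite sqrrN expr1n.
have [[L DL]|H|H] := germ_limit dD.
- have [L0|L0|L0] := ltgtP 0 L; last by rewrite {2}L0.
    have L2 : 0 < L / 2 by rewrite divr_gt0.
    case: (no_pos 1 (L / 2) one1 L2).
    have /cvgrPdist_lt/(_ _ L2) := DL; apply: filterS => t.
    by rewrite ltr_norml mul1r => /andP[_ h]; lra_from h.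
  have L2 : 0 < - L / 2 by rewrite divr_gt0// oppr_gt0.
  case: (no_pos (- 1) (- L / 2) mone L2).
  have /cvgrPdist_lt/(_ _ L2) := DL; apply: filterS => t.
  by rewrite ltr_norml mulN1r => /andP[h _]; lra_from h.
- by case: (no_pos 1 1 one1 ltr01); apply: filterS (H 1) => t; rewrite mul1r.
- case: (no_pos (- 1) 1 mone ltr01); apply: filterS (H (- 1)) => t h.
  by rewrite mulN1r; lra_from h.
Qed.

Lemma open_rotated (c s : R) (P : R -> R -> Prop) : c ^+ 2 + s ^+ 2 = 1 ->
  (forall a b, P a b -> exists2 r : R, 0 < r &
     forall a' b', `|a' - a| < r -> `|b' - b| < r -> P a' b') ->
  open [set x : 'rV[R]_2 | P ((x *m rotation c s) 0 0) ((x *m rotation c s) 0 1)].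
Proof.
move=> cs PO; rewrite openE => x /= Px; have [r r0 rP] := PO _ _ Px.
have [c1 s1] := unit_component cs.
apply/near_row2P; exists (r / 2); first by rewrite divr_gt0.
move=> z z0 z1 /=; have [-> ->] := rotation_entries c s z.
have [E0 E1] := rotation_entries c s x; apply: rP; rewrite ?E0 ?E1.
  rewrite (_ : _ - _ = (z 0 0 - x 0 0) * c + (z 0 1 - x 0 1) * s); last ring.
  exact: norm_combination_lt.
rewrite (_ : _ - _ = (z 0 1 - x 0 1) * c + (z 0 0 - x 0 0) * - s); last ring.
by apply: norm_combination_lt; rewrite ?normrN.
Qed.

(** The gap [g] makes the graph of [f] open in [X], and its closure only adds
the origin. Near 0 it is therefore open and closed in [X \ 0], and it contains
the whole connected germ. *)
Lemma germ_in_graph X (c s e : R) f g : c ^+ 2 + s ^+ 2 = 1 -> 0 < e ->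
  (forall t : R, 0 < t -> t < e -> [/\ {for t, continuous f}, {for t, continuous g},
     0 < g t, `|f t| <= t &
     forall b, `|b - f t| < g t -> X (frame_point c s t b) -> b = f t]) ->
  (forall t : R, 0 < t -> t < e -> X (frame_point c s t (f t))) ->
  connected_germ (X `\ 0) 0 ->
  \forall x \near (0 : 'rV[R]_2), X x -> x <> 0 ->
    0 < (x *m rotation c s) 0 0 < e /\
    (x *m rotation c s) 0 1 = f ((x *m rotation c s) 0 0).
Proof.
move=> cs e0 H Xf germ; pose U := rotation c s.
have UU := rotation_orthogonal cs; rewrite -/U in UU *.
pose V x := `|(x *m U) 0 0| < e /\ `|(x *m U) 0 1| < e.
have nV : \forall x \near (0 : 'rV[R]_2), V x.
  apply: (near_orthogonal (P := fun z => `|z 0 0| < e /\ `|z 0 1| < e) UU).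
  by apply/near_row2_0P; exists e.
have [W [nW WV [x0 [[Xx0 x00] Wx0]] Wc]] := germ V nV.
have {}WV x : W x -> V x by exact: WV.
pose A := (X `\ 0) `&` W.
(* Within X near 0, the graph is the part where P1 holds, and also the part where
   P2 fails; both conditions are open. *)
pose P1 (a b : R) := 0 < a /\ a < e /\ `|b - f a| < g a.
pose P2 (a b : R) := a < 0 \/ (`|a| < `|b| \/ (0 < a /\ a < e /\ b <> f a)).
pose G := A `&` [set x | P1 ((x *m U) 0 0) ((x *m U) 0 1)].
have P1open : open [set x : 'rV[R]_2 | P1 ((x *m U) 0 0) ((x *m U) 0 1)].
  apply: open_rotated => // a b [a0 [ae bg]].
  have [cf cg _ _ _] := H a a0 ae.
  pose m := (g a - `|b - f a|) / 3.
  have m0 : 0 < m by rewrite divr_gt0// subr_gt0.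
  have [d1 [d10 d1P]] := (continuous_atP _ _).1 cf _ m0.
  have [d2 [d20 d2P]] := (continuous_atP _ _).1 cg _ m0.
  exists (Num.min (Num.min d1 d2) (Num.min m (Num.min a (e - a)))).
    by rewrite !lt_min d10 d20 m0 a0 subr_gt0.
  move=> a' b'; rewrite !lt_min => /andP[/andP[/d1P fa /d2P ga] /andP[_ /andP[a1 a2]]].
  move=> /andP[_ /andP[bm _]].
  move: a1 a2; rewrite !ltr_norml => /andP[a1 _] /andP[_ a2].
  split; first lra_from a1; split; first lra_from a2.
  have -> : b' - f a' = (b' - b) + ((b - f a) + (f a - f a')) by ring.
  have n1 := ler_normD (b' - b) ((b - f a) + (f a - f a')).
  have n2 := ler_normD (b - f a) (f a - f a').
  have mE : 3 * m = g a - `|b - f a| by rewrite /m mulrC divfK.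
  move: ga; rewrite ltr_norml => /andP[g1 g2].
  clearbody m; lra_from n1 n2 mE g1 g2 fa bm.
have P2open : open [set x : 'rV[R]_2 | P2 ((x *m U) 0 0) ((x *m U) 0 1)].
  apply: open_rotated => // a b [a0|[ab|[a0 [ae bf]]]].
  - exists (- a); first by rewrite oppr_gt0.
    by move=> a' b'; rewrite ltr_norml => /andP[_ h] _; left; lra_from h.
  - exists ((`|b| - `|a|) / 2); first by rewrite divr_gt0// subr_gt0.
    move=> a' b' h1 h2; right; left.
    have n1 := ler_normD (a' - a) a; have n2 := ler_normB b' (b' - b).
    by rewrite subrK in n1; rewrite subKr in n2; lra_from n1 n2 h1 h2.
  - have [cf _ _ _ _] := H a a0 ae.
    have m0 : 0 < `|b - f a| / 2 by rewrite divr_gt0// normr_gt0 subr_eq0; apply/eqP.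
    have [d1 [d10 d1P]] := (continuous_atP _ _).1 cf _ m0.
    exists (Num.min d1 (Num.min (`|b - f a| / 2) (Num.min a (e - a)))).
      by rewrite !lt_min d10 m0 a0 subr_gt0.
    move=> a' b'; rewrite !lt_min => /andP[/d1P fa /andP[_ /andP[a1 a2]]].
    move=> /andP[_ /andP[bm _]].
    move: a1 a2; rewrite !ltr_norml => /andP[a1 _] /andP[_ a2].
    right; right; split; first lra_from a1; split; first lra_from a2.
    move=> b'f; rewrite -b'f in fa.
    have := ler_normD (f a - b') (b' - b); rewrite addrA subrK (distrC (f a)) => n1.
    by lra_from n1 fa bm.
have GE : G = A `&` ~` [set x : 'rV[R]_2 | P2 ((x *m U) 0 0) ((x *m U) 0 1)].
  apply/seteqP; split=> x [[[Xx xn0] Wx]] => [[a0 [ae bg]]|nP2]; split=> //.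
    have [_ _ _ fle gap] := H _ a0 ae.
    have bE : (x *m U) 0 1 = f ((x *m U) 0 0) by apply: gap => //; rewrite frame_pointK.
    move=> [|[|[_ [_]]]]; last by rewrite bE.
      by rewrite ltNge (ltW a0).
    by rewrite ltNge bE (ger0_norm (ltW a0)) fle.
  move: nP2; rewrite /= /P2 => /not_orP[/negP]; rewrite -leNgt => a0 /not_orP[/negP].
  rewrite -leNgt => ba nbf.
  have [Va Vb] := WV _ Wx; rewrite (ger0_norm a0) in Va ba.
  have ap : 0 < (x *m U) 0 0.
    rewrite lt_neqAle a0 andbT; apply/eqP => a00; apply: xn0.
    rewrite -a00 normr_le0 in ba; rewrite -(frame_pointK x cs) -/U -a00 (eqP ba).
    by apply: row2P; rewrite ?point0E ?point1E mxE; ring.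
  have bE : (x *m U) 0 1 = f ((x *m U) 0 0) by apply: contrapT => nb; apply: nbf.
  have [_ _ g0 _ _] := H _ ap Va.
  by split=> //; split=> //; rewrite bE subrr normr0.
have GA : G = A.
  apply: Wc.
  - have /near_sqnormP[r r0 rW] := nW.
    pose t := Num.min e r / 4; have t0 : 0 < t by rewrite divr_gt0// lt_min e0.
    have [te tr] : t < e /\ 2 * t < r.
      have [h1 h2] : Num.min e r <= e /\ Num.min e r <= r by rewrite !ge_min !lexx orbT.
      by rewrite /t; move: t0; rewrite /t => h0; split; lra_from h0 h1 h2.
    clearbody t.
    have [_ _ g0 ft _] := H t t0 te.
    exists (frame_point c s t (f t)).
    have [E0 E1] := frame_point_rotation t (f t) cs; rewrite -/U in E0 E1.
    split; last by rewrite /= E0 E1; split=> //; split=> //; rewrite subrr normr0.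
    split; first split; first exact: Xf.
      by move=> /= p0; move: E0; rewrite p0 mul0mx mxE => t0'; rewrite -t0' ltxx in t0.
    apply: rW; rewrite -(sqnorm_orthogonal _ UU) /sqnorm E0 E1.
    move: ft; rewrite ler_norml => /andP[f1 f2].
    have h1 : 0 <= (t - f t) * (t + f t) by rewrite mulr_ge0//; [lra_from f2|lra_from f1].
    have h2 : 0 < (r - 2 * t) * (r + 2 * t) by rewrite mulr_gt0//; lra_from t0 tr.
    have h3 : 0 < t * t by rewrite mulr_gt0.
    by lra_from h1 h2 h3.
  - by exists [set x | P1 ((x *m U) 0 0) ((x *m U) 0 1)].
  - exists (~` [set x | P2 ((x *m U) 0 0) ((x *m U) 0 1)]) => //.
    exact: open_closedC.
apply: filterS nW => x Wx Xx xn0.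
have : A x by [].
rewrite -GA => -[[[_ _] _] [a0 [ae bg]]]; split; first by rewrite a0.
have [_ _ _ _ gap] := H _ a0 ae.
by apply: gap => //; rewrite frame_pointK.
Qed.

End GraphGerm.

(** * The characterization *)

Section Characterization.
Variables (R : realType) (S : ominimal_structure R).
Implicit Types (X : set 'rV[R]_2) (x y z p u : 'rV[R]_2) (f g : R -> R).

(** In the frame of a tangent direction, the fibres of [X] over small positive
abscissas have a definable lowest selection [f], which is tangent to the axis.
It is [C^1] as a definable germ, and all of [X] near 0 is its graph. *)
Lemma branch_exists X : closed X -> definable_curve S X -> X 0 ->
  connected_germ (X `\ 0) 0 ->
  exists U e f, [/\ branch_at0 S X U e f, def_fun S f &
    forall eps : R, 0 < eps -> \forall t \near 0^'+, `|f t| <= eps * t].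
Proof.
move=> cX [dX dimX] X0 germ.
have clX : closure (X `\ 0) 0.
  by move=> B nB; have [W [_ WB [x [Xx Wx]] _]] := germ B nB; exists x; split=> //; exact: WB.
have [u [u1 cone]] := tangent_direction clX.
pose c := u 0 0; pose s := u 0 1.
have cs : c ^+ 2 + s ^+ 2 = 1 by exact: u1.
pose Y a b := X (frame_point c s a b).
have dY : def_rel S Y.
  have dQ : def_rel S (fun a b => X (point a b)) := definable_def_rel dX.
  rewrite /def_rel /Y /frame_point.
  apply: (def_pred2 (Q := fun a b => X (point a b)) (t := fun r => r 0 * c - r 1 * s)
     (u := fun r => r 0 * s + r 1 * c)) => //; definability.
pose U := rotation c s.
have UU : U *m U^T = 1%:M by exact: rotation_orthogonal.
have [c1 s1] := unit_component cs.
have Y_closed a b : ~ Y a b -> exists2 r : R, 0 < r &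
    forall a' b', `|a' - a| < r -> `|b' - b| < r -> ~ Y a' b'.
  move=> nY; have : \forall x \near frame_point c s a b, ~ X x.
    have oX : open (~` X) := closed_openC cX.
    exact: (open_nbhs_nbhs (conj oX nY)).
  move=> /near_row2P[r r0 rP]; exists (r / 2); first by rewrite divr_gt0.
  move=> a' b' aa bb; apply: rP; rewrite ?point0E ?point1E.
    rewrite (_ : _ - _ = (a' - a) * c + (b' - b) * - s); last ring.
    by apply: norm_combination_lt; rewrite ?normrN.
  rewrite (_ : _ - _ = (a' - a) * s + (b' - b) * c); last ring.
  exact: norm_combination_lt.
have Y_thin a0 b0 r : 0 < r -> exists a b : R, [/\ `|a - a0| < r, `|b - b0| < r & ~ Y a b].
  move=> r0; have r2 : 0 < r / 2 by rewrite divr_gt0.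
  pose p := frame_point c s a0 b0.
  have [x [x0 x1 nX]] := thin_of_dimension dimX p r2.
  exists ((x *m U) 0 0), ((x *m U) 0 1); rewrite /Y (frame_pointK _ cs).
  have [E0 E1] := frame_point_rotation a0 b0 cs; have [-> ->] := rotation_entries c s x.
  have [F0 F1] := rotation_entries c s p.
  split=> //.
    rewrite -[in X in _ - X]E0 F0.
    rewrite (_ : _ - _ = (x 0 0 - p 0 0) * c + (x 0 1 - p 0 1) * s); last ring.
    exact: norm_combination_lt.
  rewrite -[in X in _ - X]E1 F1.
  rewrite (_ : _ - _ = (x 0 1 - p 0 1) * c + (x 0 0 - p 0 0) * - s); last ring.
  by apply: norm_combination_lt; rewrite ?normrN.
have Y00 : Y 0 0.
  by rewrite /Y (_ : frame_point _ _ _ _ = 0)//; apply: row2P; rewrite ?point0E ?point1E mxE; ring.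
have [f [df f0 Yf fsmall]] := lowest_selection dY Y_closed Y00 cone.
have [g dg gP] := isolated_selection dY Y_thin df.
pose D := Dright f.
have dD : def_fun S D := def_Dright df.
have f00 : f t @[t --> 0^'+] --> (0 : R).
  apply/cvgrPdist_lt => eps eps0; near=> t.
  have t0 : 0 < t by near: t; exact: nbhs_right_gt.
  rewrite sub0r normrN.
  have : `|f t| <= 1 * t by near: t; exact: fsmall.
  by rewrite mul1r => /le_lt_trans; apply; near: t; exact: nbhs_right_lt.
have D0 : D t @[t --> 0^'+] --> (0 : R).
  exact: germ_limit_zero dD f00 fsmall (germ_derivable df).
have [e e0 eP] : exists2 e : R, 0 < e & forall t : R, 0 < t -> t < e ->
   [/\ [/\ {for t, continuous f}, {for t, continuous g} & `|f t| <= t],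
     0 < g t /\ (forall b, `|b - f t| < g t -> Y t b -> b = f t),
     is_derive t (1 : R) f (D t), {for t, continuous D} & Y t (f t)].
  apply/near0P.
  have cf := germ_continuous df; have cg := germ_continuous dg.
  have cD := germ_continuous dD; have f1 := fsmall 1 ltr01; have fD := germ_derivable df.
  near=> t; split; [split|by near: t|by near: t|by near: t|by near: t].
  - by near: t.
  - by near: t.
  - by rewrite -[X in _ <= X]mul1r; near: t.
have near_graph := germ_in_graph (X := X) (f := f) (g := g) cs e0.
have Xgraph : \forall x \near (0 : 'rV[R]_2), X x -> x <> 0 ->
    0 < (x *m U) 0 0 < e /\ (x *m U) 0 1 = f ((x *m U) 0 0).
  apply: near_graph => // t t0 te; have [[? ? ?] [? gap] _ _ Yt] := eP t t0 te => //.
exists U, e, f; split=> //; split=> //.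
- have -> : graph_on `[0, e[ f = [set z | (0 <= z 0 0 /\ z 0 0 < e) /\ z 0 1 = f (z 0 0)].
    apply/funext => z; apply/propext; rewrite /graph_on /= in_itv/=.
    by split=> -[/andP h1 h2]; split.
  apply: (def_rel_definable (Q := fun a b => (0 <= a /\ a < e) /\ b = f a)).
  by rewrite /def_rel; definability.
- apply: filterS Xgraph => x XxP; split=> [Xx|[]].
    have [->|/eqP xn0] := eqVneq x 0.
      by rewrite mul0mx; split; rewrite !mxE /= ?f0// in_itv/= lexx.
    have [/andP[a0 ae] bE] := XxP Xx xn0.
    by split=> //=; rewrite in_itv/= (ltW a0).
  rewrite /= in_itv/= => /andP[a0 ae] bE; rewrite -(frame_pointK x cs) -/U bE.
  move: a0 ae; rewrite le_eqVlt => /predU1P[<- _|a0 ae].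
    by rewrite f0; exact: Y00.
  by have [_ _ _ _] := eP _ a0 ae.
split=> //; exists (fun t => if t <= 0 then 0 else D t); last by rewrite lexx.
have Dsmall eps : 0 < eps -> exists2 d : R, 0 < d & forall t : R, 0 < t -> t < d -> `|D t| < eps.
  move=> eps0; apply/near0P; have /cvgrPdist_lt/(_ _ eps0) := D0.
  by apply: filterS => t; rewrite sub0r normrN.
split.
  apply/subspace_continuousP => x /=; rewrite in_itv/= => /andP[x0 xe].
  apply/cvgrPdist_lt => eps eps0.
  move: x0; rewrite le_eqVlt => /predU1P[<-|x0].
    have [d d0 dP] := Dsmall eps eps0; exists d => //= s'.
    rewrite /= sub0r normrN /from_subspace /= lexx in_itv/= => sd /andP[s0 se].
    case: ifPn; rewrite ?subr0 ?normr0// -ltNge => s0'.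
    by rewrite sub0r normrN; apply: dP => //; rewrite -(gtr0_norm s0').
  have [_ _ _ /(continuous_atP _ _).1 cD _] := eP x x0 xe.
  have [d [d0 dP]] := cD eps eps0; exists (Num.min d x); first by rewrite /= lt_min d0.
  move=> s' /=; rewrite /from_subspace /= lt_min distrC => /andP[sd sx] _.
  have s0 : 0 < s' by move: sx; rewrite ltr_norml => /andP[h _]; lra_from h.
  by rewrite (lt_geF x0) (lt_geF s0); exact: dP.
move=> t; rewrite in_itv/= => /andP[t0 te]; apply/within_dnbhsP => eps eps0.
move: t0; rewrite le_eqVlt => /predU1P[<-|t0].
  have eps2 : 0 < eps / 2 by rewrite divr_gt0.
  have /near0P[d d0 dP] := fsmall _ eps2; exists d => // s' /=.
  rewrite in_itv/= subr0 f0 subr0 lexx sub0r normrN => /andP[s0 se] sn0 sd.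
  have s0' : 0 < s' by rewrite lt_neqAle eq_sym sn0.
  rewrite normrM normfV (gtr0_norm s0') ltr_pdivrMr//.
  apply: le_lt_trans (dP s' s0' _) _; first by rewrite -(gtr0_norm s0').
  by rewrite ltr_pM2r//; lra_from eps0.
have [_ _ fD _ _] := eP t t0 te; have [d d0 dP] := is_derive_slope fD eps0.
by exists d => // s' _ st sd; rewrite (lt_geF t0); exact: dP.
Unshelve. all: by end_near. Qed.

(** The exponent is read off from the bounds: [h <= t] excludes [al < 1], and
[M t ^+ 2 <= h] for all [M] excludes [2 <= al]. *)
Lemma steep_power_asymptotics h : polynomially_bounded S -> def_fun S h ->
  (forall M, \forall t \near 0^'+, M * t ^+ 2 <= h t) ->
  (\forall t \near 0^'+, h t <= t) ->
  exists a al : R, [/\ 0 < a, 1 <= al, al < 2 &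
    forall eps : R, 0 < eps -> \forall t \near 0^'+, `|h t - a * t `^ al| <= eps * t `^ al].
Proof.
move=> hS dh hlb hub.
have hlb1 : \forall t \near 0^'+, t ^+ 2 <= h t.
  by apply: filterS (hlb 1) => t; rewrite mul1r.
have [a [al [a0 hal]]] := germ_power_asymptotics hS dh hlb1 hub.
have asym eps : 0 < eps -> \forall t \near 0^'+, 0 < t /\ `|h t - a * t `^ al| <= eps * t `^ al.
  move=> eps0; near=> t; have t0 : 0 < t by near: t; exact: nbhs_right_gt.
  split=> //; have p0 : 0 < t `^ al := powR_gt0 _ t0.
  have : `|a - h t / t `^ al| <= eps.
    by near: t; move: hal => /cvgrPdist_le; exact.
  rewrite -(ler_pM2r p0) -{2}(gtr0_norm p0) -normrM mulrBl divfK ?gt_eqF//.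
  by rewrite distrC.
have a2 : 0 < a / 2 by rewrite divr_gt0.
exists a, al; split=> //.
- rewrite leNgt; apply/negP => al1.
  have al10 : 0 < 1 - al by rewrite subr_gt0.
  have pow0 := powR_cvg0 al10.
  have small : \forall t \near 0^'+, t `^ (1 - al) < a / 2.
    have /cvgrPdist_lt/(_ _ a2) := pow0.
    by apply: filterS => t; rewrite sub0r normrN ger0_norm ?powR_ge0.
  have [t [t0 _ [[_ ht] [ht1 pt]]]] := near0_ex ltr01
    (filterI (asym _ a2) (filterI hub small)).
  have p0 : 0 < t `^ al := powR_gt0 _ t0.
  have tE : t = t `^ (1 - al) * t `^ al.
    by rewrite -powRD ?subrK ?powRr1 ?ltW// gt_eqF// implybT.
  have : t < a / 2 * t `^ al by rewrite {1}tE ltr_pM2r.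
  by move: ht; rewrite ler_norml => /andP[h1 _] h2; lra_from h1 h2 ht1.
- rewrite ltNge; apply/negP => al2.
  have [t [t0 t1 [[_ ht] hb]]] := near0_ex ltr01
    (filterI (asym _ a0) (hlb (2 * a + 1))).
  have pt : t `^ al <= t ^+ 2.
    by rewrite -(powR_mulrn 2 (ltW t0)); apply: ger_powR => //; rewrite t0 ltW.
  have t20 : 0 < t ^+ 2 by rewrite exprn_gt0.
  have ap : a * t `^ al <= a * t ^+ 2 by rewrite ler_pM2l.
  by move: ht; rewrite ler_norml => /andP[_ h1]; lra_from h1 hb t20 ap.
- by move=> eps eps0; apply: filterS (asym eps eps0) => t [].
Unshelve. all: by end_near. Qed.

(** The limit of [f''] at 0 is infinite by [no_medial_axis_graph], so [f] or [- f]
dominates every multiple of [t ^+ 2]. *)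
Lemma medial_axis_superquadratic X : polynomially_bounded S -> closed X ->
  definable_curve S X -> X 0 -> connected_germ (X `\ 0) 0 ->
  closure (medial_axis X) 0 -> superquadratic_at0 S X.
Proof.
move=> hS cX dX X0 germ medial.
have [U [e [f [br df fsmall]]]] := branch_exists cX dX X0 germ.
have [UU e0 _ XU [f0 _]] := br.
have dD := def_Dright df; have fD := germ_derivable df; have DD := germ_derivable dD.
have f00 : f t @[t --> 0^'+] --> (0 : R).
  apply/cvgrPdist_lt => eps eps0; near=> t.
  rewrite sub0r normrN.
  have : `|f t| <= 1 * t by near: t; exact: fsmall.
  by rewrite mul1r => /le_lt_trans; apply; near: t; exact: nbhs_right_lt.
have D0 := germ_limit_zero dD f00 fsmall fD.
have fle : \forall t \near 0^'+, `|f t| <= t.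
  by apply: filterS (fsmall 1 ltr01) => t; rewrite mul1r.
have conclude (h : R -> R) (s : R) : s ^+ 2 = 1 -> (forall t, h t = s * f t) ->
    (forall M, \forall t \near 0^'+, M * t ^+ 2 <= h t) -> superquadratic_at0 S X.
  move=> s1 hE hM.
  have s0 : s != 0 by apply: contra_eq_neq s1 => ->; rewrite expr0n eq_sym oner_eq0.
  have ns : `|s| = 1 by apply/eqP; rewrite -(@eqrXn2 _ 2)// ?expr1n// -normrX s1 normr1.
  have dh : def_fun S h.
    have -> : h = fun t => s * f t by apply/funext.
    by rewrite /def_fun; definability.
  have hle : \forall t \near 0^'+, h t <= t.
    by apply: filterS fle => t; apply: le_trans; rewrite hE (le_trans (ler_norm _))// normrM ns mul1r.
  have [a [al [a0 al1 al2 hal]]] := steep_power_asymptotics hS dh hM hle.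
  exists U, e, f; split=> //.
    move=> fz; have [t [t0 _ [ft ht]]] := near0_ex ltr01
      (filterI fz (hM 1)).
    by move: ht; rewrite hE ft mulr0 mul1r leNgt exprn_gt0.
  exists (s * a), al; split=> //; first by rewrite mulf_neq0// gt_eqF.
  apply/eqoP => eps eps0; near=> t.
  have p0 : 0 <= t `^ al by exact: powR_ge0.
  rewrite (ger0_norm p0).
  have -> : f t - s * a * t `^ al = s * (h t - a * t `^ al).
    by rewrite hE mulrBr mulrA -expr2 s1 mul1r mulrA.
  by rewrite normrM ns mul1r; near: t; exact: hal.
have [[L DDL]|H|H] := germ_limit (def_Dright dD).
- exfalso; move: medial; rewrite (closure_medial_axis_orthogonal X UU).
  apply: (no_medial_axis_graph e0 f0 (graph_near_orthogonal UU XU) f00 fD DD (M := `|L| + 1)).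
  have /cvgrPdist_lt/(_ _ ltr01) := DDL; apply: filterS => t lt1.
  rewrite -(subKr L (Dright _ t)); apply: le_trans (ler_normB _ _) _.
  by rewrite lerD2l ltW.
- apply: (conclude f 1); [by rewrite expr1n|by move=> t; rewrite mul1r|].
  move=> M; exact: germ_derivative_ge_quadratic f00 D0 fD DD (H (2 * M)).
- apply: (conclude (fun t => - f t) (- 1)); [by rewrite sqrrN expr1n|by move=> t; rewrite mulN1r|].
  move=> M; apply: (@germ_derivative_ge_quadratic R _ (fun t => - Dright f t) (fun t => - Dright (Dright f) t)).
  + by rewrite -[X in _ --> X]oppr0; exact: cvgN.
  + by rewrite -[X in _ --> X]oppr0; exact: cvgN.
  + by apply: filterS fD => t ?; exact: is_deriveN.
  + by apply: filterS DD => t ?; exact: is_deriveN.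
  + by apply: filterS (H (- (2 * M))) => t h; lra_from h.
Unshelve. all: by end_near. Qed.

End Characterization.

Unset Implicit Arguments.
Set Strict Implicit.

Theorem proposition2p1 (R : realType) (S : ominimal_structure R)
    (hS : polynomially_bounded S) (X : set 'rV[R]_2)
    (hclosed : closed X) (hcurve : definable_curve S X)
    (h0 : X 0) (hgerm : connected_germ (X `\ 0) 0) :
  closure (medial_axis X) 0 <-> superquadratic_at0 S X.
Proof.
split; first exact: medial_axis_superquadratic.
exact: superquadratic_medial_axis.
Qed.
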